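(* Let $G=(V,E)$ be a finite simple connected graph with maximum degree $\Delta$. Suppose the Ollivier--Ricci curvature $\kappa(x,y)=1-\mathcal{W}_G(m_x,m_y)$ is computed for every edge $\{x,y\}\in E$ by running, separately for each edge, steepest descent for the function $T\mapsto \mathcal{W}_T(m_x,m_y)$ on the spanning tree state graph of $G$, started from the tree $T_{xy}$ and using the median-based exchange search at each step (all as described in the context). Then this procedure computes all edge curvatures of $G$ with the runtime estimate $$O\bigl(|E|^2|V|\Delta^2\bigr),$$ up to the lower-order cost of constructing the initial trees $T_{xy}$.
   Context: For $x\in V$, $N(x)$ is the set of neighbors of $x$, and $m_x$ is the probability density on $V$ with $m_x(z)=1/\deg(x)$ for $z\in N(x)$ and $m_x(z)=0$ otherwise. For a connected graph $H$ on $V$ with shortest path metric $d_H$ (unit edge lengths), $\mathcal{W}_H(\mu,\nu)=\inf_{\pi\in\Pi(\mu,\nu)}\sum_{u,v\in V}\pi(u,v)\,d_H(u,v)$, where $\Pi(\mu,\nu)$ is the set of couplings of $\mu$ and $\nu$. This is used for $H=G$ and for $H=T$ a spanning tree of $G$. The Ollivier--Ricci curvature of distinct vertices $x,y$ is $\kappa(x,y)=1-\mathcal{W}_G(m_x,m_y)/d_G(x,y)$, which equals $1-\mathcal{W}_G(m_x,m_y)$ when $\{x,y\}\in E$. Spanning tree state graph: its nodes are the spanning trees of $G$ (viewed as edge sets), and two trees are adjacent if they differ by a single edge exchange, i.e. one is obtained from the other by adding an edge $f$ of $G$ not in the tree and deleting another edge of the unique cycle so created. Initial tree: $T_{xy}$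 is an arbitrary extension to a spanning tree of $G$ of the tree on $\{x\}\cup N(x)\cup N(y)$ with edges $\{x,u\}$ for $u\in N(x)$ and $\{y,v\}$ for $v\in N(y)\setminus(\{x\}\cup N(x))$. Steepest descent: from the current tree, repeatedly move to an adjacent tree of strictly smaller cost $\mathcal{W}_T(m_x,m_y)$ found by the exchange search below, until no adjacent tree has strictly smaller cost. The final tree $T_\star$ satisfies $\mathcal{W}_{T_\star}(m_x,m_y)=\mathcal{W}_G(m_x,m_y)$, and $\kappa(x,y)=1-\mathcal{W}_{T_\star}(m_x,m_y)$. Median-based exchange search at a tree $T$: for an oriented edge $g=(u,v)$ of $T$ let $s_T(g)=\sum_{z\in S_u}(m_x(z)-m_y(z))$, where $S_u$ is the connected component containing $u$ of $T$ with $\{u,v\}$ removed. These values are computed for all tree edges in linear time, and $\mathcal{W}_T(m_x,m_y)$ is the sum of $|s_T(g)|$ over the edges of $T$, each taken with one chosen orientation. For each $f\in E\setminus T$, let $e_1,\dots,e_k$ be the edges of the $T$-path joining the endpoints of $f$, oriented consistently along this path, let $s_j=s_T(e_j)$ and $s_0=0$. Exchanging $e_i$ for $f$ gives the tree $T_i=(T\setminus\{e_i\})\cup\{f\}$, with $\mathcal{W}_{T_i}(m_x,m_y)=\mathcal{W}_T(m_x,m_y)-\sum_{j=1}^k|s_j|+\sum_{j=0}^k|s_j-s_i|$. The best exchange for $f$ is found by taking $s_i$ to be a median of $0,s_1,\dots,s_k$, in time linear in the length of the fundamental cycle of $f$ with respect to $T$. The search is carried out over all $f\in E\setminus T$.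
   Formalization: Strict descent can stop at a tree with W_{T*} > W_G, so the claim that all curvatures are computed fails in general; formally the output is 1 − W_{T*}, and it is shown to equal κ(x,y) for each edge where W_{T*} = W_G. The runtime bound is unconditional. *)

(* Defs.v *)
From HB Require Import structures.
From mathcomp Require Import all_boot all_order all_algebra.
From mathcomp Require Import classical_sets reals.

Set Implicit Arguments.
Unset Strict Implicit.
Unset Printing Implicit Defensive.

Import Order.TTheory GRing.Theory Num.Theory.
Local Open Scope ring_scope.

(** * Graphs, trees and transport

    A finite simple graph on V is a symmetric irreflexive e : rel V; an edge is
    the two-element set of its endpoints, and a tree is its set of edges. *)

Definition nbhd (V : finType) (e : rel V) (x : V) : {set V} := [set z | e x z].

Definition deg (V : finType) (e : rel V) (x : V) : nat := #|nbhd e x|.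

Definition maxdeg (V : finType) (e : rel V) : nat := \max_(x : V) deg e x.

Definition edges (V : finType) (e : rel V) : {set {set V}} :=
  [set [set p.1; p.2] | p : V * V & e p.1 p.2].

Definition adj_of (V : finType) (T : {set {set V}}) : rel V :=
  fun u v => (u != v) && ([set u; v] \in T).

Definition connected (V : finType) (e : rel V) : Prop :=
  forall u v : V, connect e u v.

(* The length of a shortest walk; it is #|V| when v is not reachable from u. *)
Definition gdist (V : finType) (e : rel V) (u v : V) : nat :=
  find (fun n => [exists p : n.-tuple V, path e u p && (last u p == v)])
       (iota 0 #|V|).

(* A closed walk without repeated vertices is a cycle when its length exceeds
   2; [ucycle] also accepts an edge run through back and forth. *)
Definition graph_cycle (V : finType) (T : {set {set V}}) (c : seq V) : Prop :=
  (2 < size c)%N /\ ucycle (adj_of T) c.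

Definition cycle_edges (V : finType) (c : seq V) : seq {set V} :=
  [seq [set z; next c z] | z <- c].

Definition spanning_tree (V : finType) (e : rel V) (T : {set {set V}}) : Prop :=
  [/\ T \subset edges e, connected (adj_of T) & forall c, ~ graph_cycle T c].

Definition tree_adjacent (V : finType) (e : rel V) (T T' : {set {set V}}) : Prop :=
  [/\ spanning_tree e T, spanning_tree e T' &
      exists (f g : {set V}) (c : seq V),
        [/\ f \in edges e :\: T, graph_cycle (f |: T) c,
            g \in cycle_edges c, g != f & T' = (f |: T) :\ g]].

Definition initial_tree (V : finType) (e : rel V) (x y : V) (T : {set {set V}}) : Prop :=
  spanning_tree e T /\
  [set [set x; u] | u in nbhd e x]
    :|: [set [set y; v] | v in nbhd e y :\: (x |: nbhd e x)] \subset T.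

Definition rwalk (R : realType) (V : finType) (e : rel V) (x z : V) : R :=
  if e x z then (deg e x)%:R^-1 else 0.

Definition coupling (R : realType) (V : finType) (mu nu : V -> R)
    (pi : V -> V -> R) : Prop :=
  [/\ forall u v, 0 <= pi u v,
      forall u, \sum_(v : V) pi u v = mu u &
      forall v, \sum_(u : V) pi u v = nu v].

Definition wasserstein (R : realType) (V : finType) (h : rel V) (mu nu : V -> R) : R :=
  inf [set c : R | exists2 pi : V -> V -> R, coupling mu nu pi &
         c = \sum_(u : V) \sum_(v : V) pi u v * (gdist h u v)%:R]%classic.

Definition WG (R : realType) (V : finType) (e : rel V) (x y : V) : R :=
  wasserstein e (rwalk R e x) (rwalk R e y).

Definition WT (R : realType) (V : finType) (e : rel V) (x y : V)
    (T : {set {set V}}) : R :=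
  wasserstein (adj_of T) (rwalk R e x) (rwalk R e y).

Definition curvature (R : realType) (V : finType) (e : rel V) (x y : V) : R :=
  1 - WG R e x y / (gdist e x y)%:R.

(* [steepest_descent R e x y T T'] : some steepest descent for T |-> W_T from T
   ends at T'.  Exchanges that leave W_T unchanged are not made, so the final
   tree is a local minimum but W_T' > W_G is possible: with x = 0, y = 1 and the
   edges 01 02 03 04 05 16 17 18 19 26 29 24 78 79 on the vertices 0..9, every
   descent from the initial tree ends at W_T' = 9/5, whereas W_G = 8/5. *)
Inductive steepest_descent (R : realType) (V : finType) (e : rel V) (x y : V) :
    {set {set V}} -> {set {set V}} -> Prop :=
| descent_stop T :
    (forall T', tree_adjacent e T T' -> WT R e x y T <= WT R e x y T') ->
    steepest_descent R e x y T T
| descent_move T T1 T2 :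
    tree_adjacent e T T1 ->
    WT R e x y T1 < WT R e x y T ->
    (forall T', tree_adjacent e T T' -> WT R e x y T1 <= WT R e x y T') ->
    steepest_descent R e x y T1 T2 ->
    steepest_descent R e x y T T2.

(** * The cost model

    Programs return a value together with their running time on a unit-cost
    random access machine with exact real arithmetic.  Every call of a recursive
    function charges one unit, and between two such charges only a bounded
    number of elementary operations is executed: arithmetic on numbers,
    comparisons, access to the head of a list, reading or writing an array cell.

    An array indexed by V is a function on V, read by application and written
    by [upd].  A tree T : {set {set V}} is a bit array indexed by edges: testing
    [set u; v] \in T, adding an edge and deleting an edge are elementary.

    The nat arguments called [fuel] only make the recursions structural. *)

Definition timed (A : Type) : Type := (A * nat)%type.

Definition ret (A : Type) (a : A) : timed A := (a, 0%N).

Definition bind (A B : Type) (m : timed A) (k : A -> timed B) : timed B :=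
  ((k m.1).1, (m.2 + (k m.1).2)%N).

Definition tick (A : Type) (m : timed A) : timed A := (m.1, m.2.+1).

Notation "'let!' x := m 'in' k" := (bind m (fun x => k))
  (at level 200, x pattern, m at level 100, k at level 200).

Definition upd (V : eqType) (A : Type) (a : V -> A) (v : V) (z : A) : V -> A :=
  fun w => if w == v then z else a w.

Definition newarray (V : finType) (A : Type) (f : V -> A) : timed (V -> A) :=
  (f, #|V|).

(** * Linear time selection (median of medians, groups of five) *)

Fixpoint len (A : Type) (l : seq A) : timed nat :=
  tick (if l is _ :: l' then let! n := len l' in ret n.+1 else ret 0%N).

Fixpoint insert (A : Type) (le : rel A) (a : A) (l : seq A) : timed (seq A) :=
  tick (if l is b :: l' then
          if le a b then ret (a :: l)
          else let! r := insert le a l' in ret (b :: r)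
        else ret [:: a]).

Fixpoint isort (A : Type) (le : rel A) (l : seq A) : timed (seq A) :=
  tick (if l is a :: l' then let! r := isort le l' in insert le a r
        else ret [::]).

Fixpoint item (A : Type) (d : A) (l : seq A) (k : nat) : timed A :=
  tick (match l, k with
        | [::], _ => ret d
        | a :: _, 0 => ret a
        | _ :: l', k'.+1 => item d l' k'
        end).

Fixpoint group_medians (A : Type) (le : rel A) (d : A) (l : seq A) : timed (seq A) :=
  tick (if l is [:: a1, a2, a3, a4, a5 & l'] then
          let! s := isort le [:: a1; a2; a3; a4; a5] in
          let! m := item d s 2 in
          let! r := group_medians le d l' in
          ret (m :: r)
        else ret [::]).

(* The elements below, equivalent to and above the pivot p. *)
Fixpoint split3 (A : Type) (le : rel A) (p : A) (l : seq A) :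
    timed (seq A * seq A * seq A) :=
  tick (if l is a :: l' then
          let! (lo, eq, hi) := split3 le p l' in
          if ~~ le p a then ret (a :: lo, eq, hi)
          else if ~~ le a p then ret (lo, eq, a :: hi)
          else ret (lo, a :: eq, hi)
        else ret ([::], [::], [::])).

(* The element of rank k of l, counting from 0. *)
Fixpoint select (A : Type) (le : rel A) (d : A) (fuel : nat) (l : seq A) (k : nat) :
    timed A :=
  tick (if fuel isn't fuel'.+1 then ret d else
        let! n := len l in
        if (n <= 100)%N then let! s := isort le l in item d s k
        else
          let! ms := group_medians le d l in
          let! m := len ms in
          let! p := select le d fuel' ms m./2 in
          let! (lo, eq, hi) := split3 le p l in
          let! nlo := len lo in
          let! neq := len eq in
          if (k < nlo)%N then select le d fuel' lo k
          else if (k < nlo + neq)%N then ret p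
          else select le d fuel' hi (k - (nlo + neq))%N).

(** * Setting up the masses m_x - m_y from the list of edges *)

Fixpoint count_degree (V : finType) (x : V) (es : seq (V * V)) : timed nat :=
  tick (if es is (u, v) :: es' then
          let! n := count_degree x es' in
          ret (if (u == x) || (v == x) then n.+1 else n)
        else ret 0%N).

Fixpoint spread (R : realType) (V : finType) (x : V) (w : R) (es : seq (V * V))
    (a : V -> R) : timed (V -> R) :=
  tick (if es is (u, v) :: es' then
          spread x w es' (if u == x then upd a v (a v + w)
                          else if v == x then upd a u (a u + w) else a)
        else ret a).

Definition masses (R : realType) (V : finType) (es : seq (V * V)) (x y : V) :
    timed (V -> R) :=
  let! dx := count_degree x es in
  let! dy := count_degree y es in
  let! a := newarray (fun _ : V => 0 : R) in
  let! a1 := spread x dx%:R^-1 es a in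
  spread y (- dy%:R^-1) es a1.

(** * Rooting a tree and computing the values s_T *)

Fixpoint tree_neighbors (V : finType) (T : {set {set V}}) (es : seq (V * V))
    (nb : V -> seq V) : timed (V -> seq V) :=
  tick (if es is (u, v) :: es' then
          tree_neighbors T es'
            (if [set u; v] \in T
             then let nb1 := upd nb u (v :: nb u) in upd nb1 v (u :: nb1 v)
             else nb)
        else ret nb).

Fixpoint push_children (V : finType) (v : V) (ws st : seq V) (par : V -> V)
    (dep : V -> nat) : timed (seq V * (V -> V) * (V -> nat)) :=
  tick (if ws is w :: ws' then
          if w == par v then push_children v ws' st par dep
          else push_children v ws' (w :: st) (upd par w v) (upd dep w (dep v).+1)
        else ret (st, par, dep)).

(* Depth first search; the result is the array of parents, the array of depths
   and the list of visited vertices, last visited first. *)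
Fixpoint dfs (V : finType) (fuel : nat) (nb : V -> seq V) (st : seq V)
    (par : V -> V) (dep : V -> nat) (ord : seq V) :
    timed ((V -> V) * (V -> nat) * seq V) :=
  tick (match fuel, st with
        | fuel'.+1, v :: st' =>
            let! (st1, par1, dep1) := push_children v (nb v) st' par dep in
            dfs fuel' nb st1 par1 dep1 (v :: ord)
        | _, _ => ret (par, dep, ord)
        end).

Definition root_tree (V : finType) (es : seq (V * V)) (T : {set {set V}}) (r : V) :
    timed ((V -> V) * (V -> nat) * seq V) :=
  let! nb0 := newarray (fun _ : V => [::] : seq V) in
  let! nb := tree_neighbors T es nb0 in
  let! par := newarray (fun v : V => v) in
  let! dep := newarray (fun _ : V => 0%N) in
  dfs #|V| nb [:: r] par dep [::].

(* With [s] initially m_x - m_y, the final value of [s v] for v != r is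
   s_T(v, par v). *)
Fixpoint subtree_sums (R : realType) (V : finType) (par : V -> V) (r : V)
    (ord : seq V) (s : V -> R) : timed (V -> R) :=
  tick (if ord is v :: ord' then
          subtree_sums par r ord'
            (if v == r then s else upd s (par v) (s (par v) + s v))
        else ret s).

Fixpoint tree_cost (R : realType) (V : finType) (r : V) (ord : seq V) (s : V -> R) :
    timed R :=
  tick (if ord is v :: ord' then
          let! c := tree_cost r ord' s in
          ret (if v == r then c else `|s v| + c)
        else ret 0).

(** * Median-based exchange search

    The tree edge {v, par v} is represented by its lower end v. *)

(* The edges of the tree path from a to b, in no particular order, each with
   the value of s_T in the direction from a to b. *)
Fixpoint tree_path (R : realType) (V : finType) (fuel : nat) (par : V -> V)
    (dep : V -> nat) (s : V -> R) (a b : V) (acc : seq (R * option V)) :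
    timed (seq (R * option V)) :=
  tick (if fuel isn't fuel'.+1 then ret acc
        else if a == b then ret acc
        else if (dep b <= dep a)%N
        then tree_path fuel' par dep s (par a) b ((s a, Some a) :: acc)
        else tree_path fuel' par dep s a (par b) ((- s b, Some b) :: acc)).

Fixpoint deviation (R : realType) (A : Type) (t : R) (l : seq (R * A)) : timed R :=
  tick (if l is p :: l' then
          let! c := deviation t l' in ret (`|p.1 - t| + c)
        else ret 0).

(* The decrease of the cost achieved by a best exchange for the edge {a, b},
   and the edge to delete; the pair (0, None) is the entry s_0. *)
Definition best_exchange (R : realType) (V : finType) (par : V -> V)
    (dep : V -> nat) (s : V -> R) (a b : V) : timed (R * option V) :=
  let! l := tree_path #|V| par dep s a b [::] in
  let l0 := (0, None) :: l in
  let! n := len l0 in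
  let! m := select (fun p q : R * option V => p.1 <= q.1) (0, None) n.+1 l0 n./2 in
  let! old := deviation 0 l0 in
  let! new := deviation m.1 l0 in
  ret (old - new, m.2).

(* [best] holds the largest decrease found so far, the edge to add and the edge
   to delete. *)
Fixpoint search (R : realType) (V : finType) (T : {set {set V}}) (par : V -> V)
    (dep : V -> nat) (s : V -> R) (es : seq (V * V))
    (best : R * option ({set V} * {set V})) :
    timed (R * option ({set V} * {set V})) :=
  tick (if es is (a, b) :: es' then
          if [set a; b] \in T then search T par dep s es' best
          else
            let! (gain, del) := best_exchange par dep s a b in
            search T par dep s es'
              (if del is Some v then
                 if best.1 < gain
                 then (gain, Some ([set a; b], [set v; par v])) else best
               else best)
        else ret best).

(* One round at the tree T: its cost, and the next tree if an exchange of
   strictly smaller cost was found.  [mass] is the array m_x - m_y. *)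
Definition descent_round (R : realType) (V : finType) (es : seq (V * V)) (r : V)
    (mass : V -> R) (T : {set {set V}}) : timed (R * option {set {set V}}) :=
  let! (par, dep, ord) := root_tree es T r in
  let! s0 := newarray mass in
  let! s := subtree_sums par r ord s0 in
  let! c := tree_cost r ord s in
  let! best := search T par dep s es (0, None) in
  ret (c, if best.2 is Some (f, g) then Some ((f |: T) :\ g) else None).

(* The loop started at T stops at T', whose computed cost is w, after time n. *)
Inductive descent_loop (R : realType) (V : finType)
    (round : {set {set V}} -> timed (R * option {set {set V}})) :
    {set {set V}} -> {set {set V}} -> R -> nat -> Prop :=
| loop_stop T w n :
    round T = ((w, None), n) -> descent_loop round T T w n
| loop_move T T1 T2 w1 w n1 n :
    round T = ((w1, Some T1), n1) ->
    descent_loop round T1 T2 w n ->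
    descent_loop round T T2 w (n1 + n)%N.

(* The computation for the edge p, started at the tree T, stops at T' and
   returns k after time n. *)
Definition edge_run (R : realType) (V : finType) (es : seq (V * V)) (p : V * V)
    (T T' : {set {set V}}) (k : R) (n : nat) : Prop :=
  let m := masses R es p.1 p.2 in
  exists (w : R) (n' : nat),
    [/\ descent_loop (descent_round es p.1 m.1) T T' w n',
        k = 1 - w & n = (m.2 + n')%N].

(* The input: every edge of the graph listed once, in one of its two
   orientations. *)
Definition edge_list (V : finType) (e : rel V) (es : seq (V * V)) : Prop :=
  let E := [seq [set p.1; p.2] | p <- es] in uniq E /\ E =i edges e.

(* Main.v *)
Require Import Defs.
From HB Require Import structures.
From mathcomp Require Import classical_sets reals.
From mathcomp Require Import all_boot all_order all_algebra.
From mathcomp Require Import zify ring lra.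

Set Implicit Arguments.
Unset Strict Implicit.
Unset Printing Implicit Defensive.

Import Order.TTheory GRing.Theory Num.Theory.
Local Open Scope ring_scope.

(** Fix an edge {x, y} and let mass = m_x - m_y.

    The transport cost on a tree is a flow cost.  A flow on a tree with
    divergence mass has cost sum |phi| equal to W_T: the coupling which ships
    every excess from the leaves towards the root costs sum |s_T|
    ([sums_coupling]), and a 1-Lipschitz potential whose increments follow the
    signs of phi shows by summation by parts that no coupling is cheaper
    ([tree_wasserstein], [flow_cost_unique]).

    The exchange formula follows from it.  If f = {a, b} replaces an edge e_i of
    the tree path from a to b, then adding s_i times the circulation that runs
    along f from a to b and back along the path turns the flow of T into a flow
    of the new tree, so the new cost is obtained by replacing each |s_j| on the
    path by |s_j - s_i| and adding |s_i| for f ([exchange_cost]).  The trees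
    adjacent to T are exactly those obtained from an edge f outside T and an
    edge g of T whose deletion separates the ends of f ([exchange_tree],
    [tree_adjacentP]), and in a rooted tree these g are the edges listed by
    climbing from a and b ([anc_connect], [tree_path_perm]).  The best choice
    of s_i is a median of 0, s_1, ..., s_k ([median_min]), which linear time
    selection finds ([select_spec]).  Hence a round computes W_T and a cheapest
    adjacent tree in time O(|E| |V|) ([descent_round_spec]): the search spends
    O(|V|) on each edge outside T.

    It remains to bound the number of rounds.  All costs are multiples of
    1 / (deg x * deg y) ([tree_cost_nat]), the initial cost is at most 3
    ([initial_tree_cost]), and each move lowers the cost, so there are at most
    3 deg x deg y moves ([descent_loop_total]).  Summing the resulting
    O(|E| |V| Delta^2) over all edges gives the estimate. *)

(** * Selection in linear time *)

Lemma len_val (A : Type) (l : seq A) : (len l).1 = size l.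
Proof. by elim: l => //= a l ->. Qed.

Lemma len_time (A : Type) (l : seq A) : (len l).2 = (size l).+1.
Proof. by elim: l => //= a l ->; rewrite addn0. Qed.

Lemma item_val (A : Type) (d : A) (l : seq A) k : (item d l k).1 = nth d l k.
Proof. by elim: l k => [|a l IH] [|k] //=; apply: IH. Qed.

Lemma item_time (A : Type) (d : A) (l : seq A) k :
  ((item d l k).2 <= (size l).+1)%N.
Proof. by elim: l k => [|a l IH] [|k] //=; apply: IH. Qed.

(** With ties, m has every rank from the number of elements below it up to the
    number of elements not above it, exclusive. *)
Definition has_rank (A : eqType) (le : rel A) (l : seq A) (k : nat) (m : A) :=
  [/\ m \in l, (count (fun a => ~~ le m a) l <= k)%N &
      (k < count (fun a => le a m) l)%N].

Section Selection.
Variables (A : eqType) (le : rel A).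
Hypotheses (le_total : total le) (le_trans : transitive le).

Let le_refl : reflexive le.
Proof. by move=> a; have := le_total a a; rewrite orbb. Qed.

Lemma insert_perm a l : perm_eq (insert le a l).1 (a :: l).
Proof.
elim: l => //= b l IH; case: (le a b) => //=.
by rewrite (perm_trans (y := b :: a :: l)) ?perm_cons // (perm_catCA [:: b] [:: a]).
Qed.

Lemma insert_sorted a l : sorted le l -> sorted le (insert le a l).1.
Proof.
rewrite !(sorted_pairwise le_trans).
elim: l => //= b l IH /andP[le_bl srt_l]; case: ifP => /= le_ab.
  rewrite le_ab le_bl srt_l !andbT /=; apply/allP => c /(allP le_bl).
  exact: le_trans.
rewrite IH // andbT (perm_all _ (insert_perm a l)) /= le_bl andbT.
by have := le_total a b; rewrite le_ab.
Qed.

Lemma insert_time a l : ((insert le a l).2 <= (size l).+1)%N.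
Proof. by elim: l => //= b l IH; case: ifP => //= _; rewrite addn0. Qed.

Lemma isort_perm l : perm_eq (isort le l).1 l.
Proof.
elim: l => //= a l IH.
by rewrite (perm_trans (insert_perm _ _)) // perm_cons.
Qed.

Lemma isort_sorted l : sorted le (isort le l).1.
Proof. by elim: l => //= a l IH; apply: insert_sorted. Qed.

Lemma isort_time l : ((isort le l).2 <= (size l).+1 * (size l).+1)%N.
Proof.
elim: l => //= a l IH.
have := insert_time a (isort le l).1; rewrite (perm_size (isort_perm l)).
lia.
Qed.

Lemma sorted_rank (d : A) (s : seq A) k :
  sorted le s -> (k < size s)%N -> has_rank le s k (nth d s k).
Proof.
move=> srt ks; rewrite (sorted_pairwise le_trans) in srt.
split; first exact: mem_nth.
all: set m := nth d s k.
all: have Es : s = take k s ++ m :: drop k.+1 s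
  by rewrite -drop_nth // cat_take_drop.
all: move: srt; rewrite Es pairwise_cat /= allrel_consr => /and3P[/andP[lt _] _ /andP[rt _]].
  rewrite count_cat /= le_refl /= (_ : count _ (drop _ _) = 0%N); last first.
    by apply/eqP; rewrite eqn0Ngt -has_count -all_predC; apply: sub_all rt => a /= ->.
  by rewrite !addn0 (leq_trans (count_size _ _)) // size_take ks.
rewrite count_cat /= le_refl (_ : count _ (take _ _) = k) ?addnS ?ltnS ?leq_addr //.
by move: lt; rewrite all_count => /eqP ->; rewrite size_take ks.
Qed.

Lemma perm_rank s l k m : perm_eq s l -> has_rank le s k m -> has_rank le l k m.
Proof. by move=> p [m_s lo hi]; split; rewrite -?(perm_mem p) -?(permP p). Qed.

Lemma isort_rank (d : A) l k :
  (k < size l)%N -> has_rank le l k (nth d (isort le l).1 k).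
Proof.
move=> kl; apply: (perm_rank (isort_perm l)); apply: sorted_rank.
  exact: isort_sorted.
by rewrite (perm_size (isort_perm l)).
Qed.

(** The recursion scheme of [group_medians]. *)
Lemma seq5_ind (P : seq A -> Prop) :
  (forall l, (size l < 5)%N -> P l) ->
  (forall a1 a2 a3 a4 a5 l, P l -> P [:: a1, a2, a3, a4, a5 & l]) ->
  forall l, P l.
Proof.
move=> small big l; have [n] := ubnP (size l); elim: n l => // n IH.
case=> [|a1 [|a2 [|a3 [|a4 [|a5 l]]]]] /=; rewrite ?ltnS => ln; try exact: small.
by apply: big; apply: IH; lia.
Qed.

Lemma group_medians_cons (d a1 a2 a3 a4 a5 : A) l :
  let l5 := [:: a1; a2; a3; a4; a5] in
  (group_medians le d (l5 ++ l)).1 =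
    nth d (isort le l5).1 2 :: (group_medians le d l).1.
Proof. by move=> l5; rewrite -item_val. Qed.

Lemma group_medians_small (d : A) l : (size l < 5)%N ->
  (group_medians le d l).1 = [::].
Proof. by case: l => [|a1 [|a2 [|a3 [|a4 [|a5 l]]]]]. Qed.

Lemma group_medians_size (d : A) l :
  size (group_medians le d l).1 = (size l %/ 5)%N.
Proof.
elim/seq5_ind: l => [l sl|a1 a2 a3 a4 a5 l IH].
  by rewrite group_medians_small // divn_small.
rewrite (group_medians_cons d a1 a2 a3 a4 a5 l) /= IH; lia.
Qed.

Lemma group_medians_time (d : A) l :
  ((group_medians le d l).2 <= 9 * size l + 1)%N.
Proof.
elim/seq5_ind: l => [|a1 a2 a3 a4 a5 l IH].
  by case=> [|a1 [|a2 [|a3 [|a4 [|a5 l]]]]].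
have := isort_time [:: a1; a2; a3; a4; a5].
have := item_time d (isort le [:: a1; a2; a3; a4; a5]).1 2.
rewrite (perm_size (isort_perm _)).
change (group_medians le d [:: a1, a2, a3, a4, a5 & l]) with
 (tick (let! s := isort le [:: a1; a2; a3; a4; a5] in
          let! m := item d s 2 in
          let! r := group_medians le d l in
          ret (m :: r))).
rewrite /tick /bind /ret.
set s := isort le _; set t := item d _ _ => /=.
move=> H1 H2; lia.
Qed.

Lemma group_medians_sub (d : A) l : {subset (group_medians le d l).1 <= l}.
Proof.
elim/seq5_ind: l => [l sl|a1 a2 a3 a4 a5 l IH] b.
  by rewrite group_medians_small.
rewrite (group_medians_cons d a1 a2 a3 a4 a5 l) inE => /predU1P[->|/IH b_l].
  rewrite -[X in _ \in X]/([:: a1; a2; a3; a4; a5] ++ l) mem_cat.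
  by rewrite -(perm_mem (isort_perm _)) mem_nth // (perm_size (isort_perm _)).
by rewrite -[X in _ \in X]/([:: a1; a2; a3; a4; a5] ++ l) mem_cat b_l orbT.
Qed.

(** Each full group contributes three of its five elements on either side of its
    median, so any pivot inherits three times its rank among the medians. *)
Lemma group_medians_count (d p : A) l :
  (3 * count (fun a => le a p) (group_medians le d l).1
     <= count (fun a => le a p) l)%N /\
  (3 * count (fun a => le p a) (group_medians le d l).1
     <= count (fun a => le p a) l)%N.
Proof.
elim/seq5_ind: l => [l sl|a1 a2 a3 a4 a5 l [IH1 IH2]].
  by rewrite group_medians_small.
rewrite (group_medians_cons d a1 a2 a3 a4 a5 l).
have El : [:: a1, a2, a3, a4, a5 & l] = [:: a1; a2; a3; a4; a5] ++ l by [].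
rewrite El !count_cat.
have P5 := isort_perm [:: a1; a2; a3; a4; a5].
have := isort_sorted [:: a1; a2; a3; a4; a5].
rewrite -!(permP P5); move: (perm_size P5).
case: (isort _ _).1 => [|b1 [|b2 [|b3 [|b4 [|b5 []]]]]] //= _.
case/and5P=> b12 b23 b34 b45 _.
have b13 := le_trans b12 b23; have b35 := le_trans b34 b45.
split.
  rewrite mulnDr leq_add //; have [b3p|//] := boolP (le b3 p).
  by rewrite (le_trans b13 b3p) (le_trans b23 b3p).
rewrite mulnDr leq_add //; have [b3p|//] := boolP (le p b3).
by rewrite (le_trans b3p b35) (le_trans b3p b34); case: (le p b1); case: (le p b2).
Qed.

Lemma split3_val (p : A) l :
  (split3 le p l).1 = ([seq a <- l | ~~ le p a],
                       [seq a <- l | le p a && le a p],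
                       [seq a <- l | le p a && ~~ le a p]).
Proof.
elim: l => //= a l; rewrite /bind /ret /=; case: (split3 le p l) => [[[lo eq] hi] n] /=.
by move=> -[-> -> ->]; case: (le p a) => //=; case: (le a p).
Qed.

Lemma split3_time (p : A) l : (split3 le p l).2 = (size l).+1.
Proof.
elim: l => //= a l; rewrite /bind /ret /=; case: (split3 le p l) => [[[lo eq] hi] n] /= ->.
by case: (le p a); case: (le a p); rewrite addn0.
Qed.

Lemma count_lt_ge (p : A) l :
  (count (fun a => ~~ le p a) l + count (fun a => le p a) l = size l)%N.
Proof. by rewrite addnC -(count_predC (fun a => le p a)). Qed.

Lemma count_gt_le (p : A) l :
  (count (fun a => ~~ le a p) l + count (fun a => le a p) l = size l)%N.
Proof. by rewrite addnC -(count_predC (fun a => le a p)). Qed.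

Lemma count_lt_le (p : A) l :
  (count (fun a => ~~ le p a) l + count (fun a => le p a && le a p) l
     = count (fun a => le a p) l)%N.
Proof.
elim: l => //= a l IH; have := le_total p a.
by case: (le p a); case: (le a p) => //= _; lia.
Qed.

Lemma count_gt (p : A) l :
  count (fun a => le p a && ~~ le a p) l = count (fun a => ~~ le a p) l.
Proof.
by apply: eq_count => a /=; have := le_total p a; case: (le p a); case: (le a p).
Qed.

Lemma rank_below (p m : A) l k :
  has_rank le [seq a <- l | ~~ le p a] k m -> has_rank le l k m.
Proof.
case; rewrite mem_filter => /andP[npm m_l] lo hi; split=> //.
  apply: leq_trans lo; rewrite count_filter; apply/eq_leq/eq_count => a /=.
  case: (boolP (le p a)); rewrite ?andbT // andbF => pa.
  apply/negbTE/negPn; apply/idPn => nma; case/negP: npm; apply: le_trans pa _.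
  by have := le_total m a; rewrite (negbTE nma).
apply: leq_trans hi _; rewrite count_filter; apply: sub_count => a /=.
by case/andP.
Qed.

Lemma rank_above (p m : A) l k :
  has_rank le [seq a <- l | le p a && ~~ le a p] k m ->
  has_rank le l (count (fun a => le a p) l + k) m.
Proof.
case; rewrite mem_filter => /andP[/andP[pm nmp] m_l].
rewrite !count_filter => lo hi; split=> //.
  apply: (leq_trans _ (leq_add (leqnn _) lo)).
  elim: {m_l lo hi} l => //= a l; have := le_total p a.
  by case: (le p a); case: (le a p) => //= _; case: (le m a) => //=; lia.
rewrite -addnS (leq_trans (leq_add (leqnn _) hi)) //.
elim: {m_l lo hi} l => //= a l; have := le_total p a.
have : le a p -> le a m by move/le_trans; apply.
by case: (le p a); case: (le a p) => //=; case: (le a m) => //=; lia.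
Qed.

(** A pivot of middle rank among the medians of n %/ 5 groups leaves at most
    7n/10 + 6/5 elements on either side, and 1/5 + 7/10 < 1 makes the two
    recursive calls together linear. *)
Lemma select_spec (d : A) fuel l k : (size l < fuel)%N -> (k < size l)%N ->
  has_rank le l k (select le d fuel l k).1 /\
  ((select le d fuel l k).2 <= 200 * size l + 20)%N.
Proof.
elim: fuel l k => // fuel IH l k; rewrite ltnS => size_l k_l.
rewrite /= /bind /= len_val len_time; case: ifP => [small|/negbT].
  rewrite item_val; split; first exact: isort_rank.
  have := isort_time l; have := item_time d (isort le l).1 k.
  have : ((size l).+1 * (size l).+1 <= 101 * (size l).+1)%N by rewrite leq_mul2r.
  rewrite (perm_size (isort_perm l)) len_time /=; lia.
rewrite -ltnNge => big; rewrite !len_val !len_time.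
set ms := (group_medians le d l).1.
have size_ms : size ms = (size l %/ 5)%N by exact: group_medians_size.
have [||[p_ms p_lo p_hi] p_time] := IH ms (size ms)./2; try lia.
move: p_ms p_lo p_hi p_time; set p := (select le d fuel ms _).1.
move=> p_ms p_lo p_hi p_time.
have p_l : p \in l by apply: group_medians_sub p_ms.
have [c_le c_ge] := group_medians_count d p l; rewrite -/ms in c_le c_ge.
have := split3_time p l; have := split3_val p l; have := group_medians_time d l.
case: (split3 le p l) => [[[lo eq] hi] t] /= gt [-> -> ->] -> {lo eq hi t}.
rewrite !len_val !len_time !size_filter.
have := count_lt_le p l; have := count_gt p l.
have := count_lt_ge p l; have := count_gt_le p l; have := count_lt_ge p ms.
set lo := count (fun a => ~~ le p a) l; set eq := count (fun a => le p a && le a p) l.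
move=> eq1 eq2 eq3 eq4 eq5.
case: ifP => [k_lo|/negbT]; last (rewrite -leqNgt => k_lo; case: ifP => [k_eq|/negbT]).
- have [||r t] := IH [seq a <- l | ~~ le p a] k; rewrite ?size_filter -/lo; try lia.
  split; first exact: rank_below r.
  rewrite size_filter -/lo in t; lia.
- by rewrite /ret /=; split; [split=> //; lia | lia].
rewrite -leqNgt => k_eq.
have [||r t] := IH [seq a <- l | le p a && ~~ le a p] (k - (lo + eq))%N;
  rewrite ?size_filter; try lia.
rewrite size_filter in t; split; last by lia.
by have := rank_above r; rewrite -eq5 subnKC.
Qed.

End Selection.

(** * Trees, bridges and edge exchanges *)

Section Trees.
Variable V : finType.
Implicit Types (T : {set {set V}}) (f g : {set V}) (u v w a b : V).

Lemma adj_sym T : symmetric (adj_of T).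
Proof. by move=> u v; rewrite /adj_of eq_sym setUC. Qed.

Lemma adj_irr T : irreflexive (adj_of T).
Proof. by move=> u; rewrite /adj_of eqxx. Qed.

Lemma connect_adj_sym T : connect_sym (adj_of T).
Proof. exact/sym_connect_sym/adj_sym. Qed.

Lemma set2_inj u v a b : [set u; v] = [set a; b] ->
  (u = a /\ v = b) \/ (u = b /\ v = a).
Proof.
move=> E; have: u \in [set a; b] by rewrite -E set21.
have: v \in [set a; b] by rewrite -E set22.
have: a \in [set u; v] by rewrite E set21.
have: b \in [set u; v] by rewrite E set22.
rewrite !inE => /orP[]/eqP h1 /orP[]/eqP h2 /orP[]/eqP h3 /orP[]/eqP h4;
  by [left; split; congruence | right; split; congruence].
Qed.

Lemma adjD1 T g u v : adj_of (T :\ g) u v = adj_of T u v && ([set u; v] != g).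
Proof. by rewrite /adj_of in_setD1; case: (_ == g); rewrite ?andbF ?andbT. Qed.

Lemma adj_sub T T' : T \subset T' -> subrel (adj_of T) (adj_of T').
Proof. by move/subsetP=> sTT u v /andP[uv /sTT T'uv]; rewrite /adj_of uv. Qed.

Lemma connect_mono T T' u v : T \subset T' ->
  connect (adj_of T) u v -> connect (adj_of T') u v.
Proof.
move=> sT; apply: connect_sub => a b /(adj_sub sT); exact: connect1.
Qed.

Definition all_bridges T : Prop :=
  forall u v, adj_of T u v -> ~~ connect (adj_of (T :\ [set u; v])) u v.

(** A simple path from u to v closed by the missing edge {u, v} is a cycle, and
    the path survives the deletion of any edge off that cycle. *)
Lemma joining_path_cycle T u v :
  u != v -> [set u; v] \notin T -> connect (adj_of T) u v ->
  exists c, graph_cycle ([set u; v] |: T) c /\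
   forall g, g \notin cycle_edges c -> connect (adj_of (T :\ g)) u v.
Proof.
move=> uv nuv /connectP[p0 pth0 lst0].
move: pth0 lst0; case/shortenP=> p pth unq _ lst {p0}.
exists (u :: p); split; first split.
- case: p pth {unq} lst => [|w [|w' p]] //=; first by move=> _ E; rewrite E eqxx in uv.
  by rewrite andbT => /andP[_ uw] E; rewrite E uw in nuv.
- rewrite /ucycle unq andbT /= rcons_path.
  rewrite (sub_path (adj_sub (subsetUr _ _)) pth) -lst /adj_of eq_sym uv.
  by rewrite setUC setU11.
move=> g ng; apply/connectP; exists p => //.
have Enext : forall w w' p1 p2, u :: p = p1 ++ w :: w' :: p2 -> next (u :: p) w = w'.
  move=> w w' p1 p2 E; have := unq; rewrite {1}E => unq'.
  have nw : w \notin p1.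
    by move: unq'; rewrite cat_uniq => /and3P[_ /hasPn/(_ w) + _]; apply; rewrite mem_head.
  have w_c : w \in u :: p by rewrite E mem_cat mem_head orbT.
  have iw : index w (u :: p) = size p1 by rewrite E index_cat (negbTE nw) /= eqxx addn0.
  rewrite next_nth w_c iw.
  case: p1 E {unq' nw iw} => [|z p1] [_ ->] //=.
  by rewrite nth_cat ltnNge leqnSn subSnn.
have {Enext} : forall w w' p1 p2, u :: p = p1 ++ w :: w' :: p2 -> [set w; w'] != g.
  move=> w w' p1 p2 E; apply: contraNneq ng => <-.
  apply/mapP; exists w; first by rewrite E mem_cat mem_head orbT.
  by rewrite (Enext _ _ _ _ E).
elim: p u pth {unq uv nuv lst ng} => //= w p IH u /andP[uw pth] H.
rewrite adjD1 uw (H u w [::] p) //=.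
by apply: IH => // w1 w2 p1 p2 E; apply: (H w1 w2 (u :: p1) p2); rewrite E.
Qed.

(** The rest of a cycle joins the ends of its first edge. *)
Lemma cycle_connect T a b s : ucycle (adj_of T) [:: a, b & s] -> (0 < size s)%N ->
  connect (adj_of (T :\ [set a; b])) a b.
Proof.
case: s => // z s /andP[/= /and3P[ab bz pth] /andP[]].
rewrite !inE !negb_or => /and3P[nab naz nas] /andP[/andP[nbz nbs] _] _.
rewrite connect_adj_sym; apply/connectP; exists (z :: rcons s a); last by rewrite /= last_rcons.
have nb_s x : x \in z :: rcons s a -> x != b.
  rewrite inE mem_rcons inE => /or3P[/eqP->|/eqP->|xs] //; first by rewrite eq_sym.
  by apply: contraNneq nbs => <-.
rewrite /= adjD1 bz /=; apply/andP; split.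
  by apply/eqP => /set2_inj[[E _]|[_ E]]; [case/eqP: nab | case/eqP: naz].
apply: (sub_in_path (P := [pred x | x != b])) pth; last by apply/allP => x /nb_s.
move=> x y /= xb yb xy; rewrite adjD1 xy /=.
by apply/eqP => /set2_inj[[_ E]|[E _]]; [case/eqP: yb | case/eqP: xb].
Qed.

(** Two ends joined away from their edge give a cycle with that edge, and each
    edge of a cycle has its ends joined by the rest of the cycle. *)
Lemma acyclicP T : (forall c, ~ graph_cycle T c) <-> all_bridges T.
Proof.
split=> [acyc u v uv|bridges c [sz_c]].
  apply/negP => uv'; have /andP[nuv uvT] := uv.
  have [|c [cyc _]] := joining_path_cycle nuv _ uv'; first by rewrite in_setD1 eqxx.
  by apply: (acyc c); rewrite setD1K in cyc.
case: c sz_c => [|a [|b s]] // sz_c cyc.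
have ab : adj_of T a b by case/andP: cyc => /= /andP[].
by case/negP: (bridges _ _ ab); apply: cycle_connect cyc _; case: s sz_c.
Qed.

Lemma cycle_edges_connect T c g : graph_cycle T c -> g \in cycle_edges c ->
  exists a b, [/\ g = [set a; b], adj_of T a b & connect (adj_of (T :\ g)) a b].
Proof.
case=> sz_c cyc /mapP[a a_c ->]; case: (rot_to a_c) => i c' E.
have : ucycle (adj_of T) (a :: c') by rewrite -E rot_ucycle.
have : next c a = next (a :: c') a.
  by rewrite -E next_rot //; case/andP: cyc.
have : size (a :: c') = size c by rewrite -E size_rot.
case: c' {E} => [|b s] /= Es; first by rewrite -Es in sz_c.
rewrite eqxx => -> cyc'; exists a, b; split=> //.
  by case/andP: cyc' => /= /andP[].
by apply: cycle_connect cyc' _; rewrite -Es in sz_c.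
Qed.

Lemma connect_add_edge (r r' : rel V) a b : connect_sym r ->
  (forall u v, r' u v -> r u v || ([set u; v] == [set a; b])) ->
  forall u v, connect r' u v ->
  [\/ connect r u v, connect r u a /\ connect r b v | connect r u b /\ connect r a v].
Proof.
move=> sym add u v /connectP[p pth ->] {v}.
elim: p u pth => [|w p IH] u /=; first by constructor 1.
case/andP=> uw /IH {IH} IH.
have {}uw : connect r u w \/ [set u; w] = [set a; b].
  by case/orP: (add _ _ uw) => [/connect1|/eqP]; auto.
case: uw => [uw|/set2_inj[[-> E]|[-> E]]].
2: { rewrite E in IH *; case: IH => [?|[? ?]|[_ ?]];
     [constructor 2|constructor 2|constructor 1]; by rewrite ?connect0. }
2: { rewrite E in IH *; case: IH => [?|[_ ?]|[? ?]];
     [constructor 3|constructor 1|constructor 3]; by rewrite ?connect0. }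
case: IH => [wv|[wa bv]|[wb av]].
- by constructor 1; apply: connect_trans uw wv.
- by constructor 2; split=> //; apply: connect_trans uw wa.
by constructor 3; split=> //; apply: connect_trans uw wb.
Qed.

Section Exchange.
Variable e : rel V.

Lemma edgesP f : reflect (exists a b, f = [set a; b] /\ e a b) (f \in edges e).
Proof.
apply: (iffP imsetP) => [[[a b] ab ->]|[a [b [-> ab]]]].
  by rewrite inE in ab; exists a, b.
by exists (a, b); rewrite ?inE.
Qed.

Hypothesis e_irr : irreflexive e.

Lemma spanning_treeP T :
  spanning_tree e T <-> [/\ T \subset edges e, connected (adj_of T) & all_bridges T].
Proof. by split=> -[? ? /acyclicP]. Qed.

(** Since a and b are joined in T but not in T minus g, the ends of g are joined
    in T minus g by way of f, so the new graph is connected.  Its edges are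
    bridges: f because deleting g separates a from b, and any other edge h
    because a detour around h through f would join a to b in T minus g. *)
Lemma exchange_tree T a b g : spanning_tree e T ->
  [set a; b] \in edges e :\: T -> g \in T ->
  ~~ connect (adj_of (T :\ g)) a b ->
  tree_adjacent e T (([set a; b] |: T) :\ g).
Proof.
move=> sT; have /spanning_treeP[sub con bri] := sT.
set f := [set a; b]; rewrite inE => /andP[fT fE] gT nab.
have nfg : g != f by apply: contraNneq fT => <-.
have ab : a != b by apply: contraNneq nab => ->; apply: connect0.
have [c [d [Eg cd]]] := edgesP _ (subsetP sub _ gT).
have nf x y : adj_of (f |: T) x y -> ([set x; y] == f) || adj_of T x y.
  by rewrite /adj_of in_setU1 => /andP[-> /orP[->|->]]; rewrite ?orbT.
have sTg : T :\ g \subset (f |: T) :\ g by apply: setSD; apply: subsetUr.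
have cab : connect (adj_of T) a b by apply: con.
have sT' : spanning_tree e ((f |: T) :\ g).
  apply/spanning_treeP; split.
  - apply: subset_trans (subsetDl _ _) _.
    by rewrite subUset sub sub1set fE.
  - move=> u v; have := con u v; apply: connect_sub => {u v} u v uv.
    have [E|nE] := eqVneq [set u; v] g; last first.
      by apply: connect1; apply: adj_sub sTg _ _ _; rewrite adjD1 uv.
    have fab : adj_of ((f |: T) :\ g) a b.
      by rewrite adjD1 /adj_of ab setU11 /= eq_sym.
    have mono := connect_mono sTg.
    have sym := connect_adj_sym ((f |: T) :\ g).
    (* A path of T from a to b must use g = {u, v}. *)
    have addg x y : adj_of T x y -> adj_of (T :\ g) x y || ([set x; y] == [set u; v]).
      by move=> xy; rewrite adjD1 xy E; case: eqP.
    have := connect_add_edge (connect_adj_sym (T :\ g)) addg cab.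
    case=> [|[/mono au /mono vb]|[/mono av /mono ub]]; first by rewrite (negbTE nab).
      rewrite sym in au; apply: connect_trans au (connect_trans (connect1 fab) _).
      by rewrite sym.
    apply: connect_trans ub _; rewrite sym.
    by apply: connect_trans _ (connect1 fab); rewrite sym.
  move=> u v; rewrite adjD1 => /andP[uv nuvg].
  have [E|nE] := eqVneq [set u; v] f.
    have -> : (f |: T) :\ g :\ [set u; v] = T :\ g.
      apply/setP => h; rewrite E !inE; case: eqP => //= ->.
      by rewrite (negbTE fT) andbF.
    by case: (set2_inj E) => [[-> ->]|[-> ->]]; rewrite ?(connect_adj_sym _ b).
  have uvT : adj_of T u v by move: (nf _ _ uv); rewrite (negbTE nE).
  have addf x y : adj_of ((f |: T) :\ g :\ [set u; v]) x y ->
      adj_of (T :\ g :\ [set u; v]) x y || ([set x; y] == f).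
    by rewrite !adjD1 => /andP[/andP[/nf /orP[->|-> ->->//]]]; rewrite orbT.
  apply/negP => /(connect_add_edge (connect_adj_sym _) addf)[].
  - rewrite setDDl setUC -setDDl; move/(connect_mono (subsetDl _ _)).
    exact/negP/bri.
  - case=> ua bv; case/negP: nab.
    have mono := connect_mono (subsetDl (T :\ g) [set [set u; v]]).
    have sym := connect_adj_sym (T :\ g).
    apply: (@connect_trans _ _ u); first by rewrite sym; apply: mono.
    apply: (@connect_trans _ _ v); last by rewrite sym; apply: mono.
    by apply: connect1; rewrite adjD1 uvT.
  case=> ub av; case/negP: nab.
  have mono := connect_mono (subsetDl (T :\ g) [set [set u; v]]).
  have sym := connect_adj_sym (T :\ g).
  apply: (@connect_trans _ _ v); first by apply: mono.
  apply: (@connect_trans _ _ u); last by apply: mono.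
  by apply: connect1; rewrite adjD1 adj_sym uvT setUC.
have [cyc [Hcyc sep]] := joining_path_cycle ab fT cab.
split=> //; exists f, g, cyc; split=> //; first by rewrite inE fT.
by apply: contraNT nab => /sep.
Qed.

(** The separation of a and b by g is the statement that f = {a, b} is a bridge
    of the new tree. *)
Lemma tree_adjacentP T T' : tree_adjacent e T T' ->
  exists a b g, [/\ e a b, [set a; b] \notin T, g \in T,
    ~~ connect (adj_of (T :\ g)) a b & T' = ([set a; b] |: T) :\ g].
Proof.
case=> sT sT' [f [g [c [+ cyc g_c gf ET']]]].
rewrite inE => /andP[fT /edgesP[a [b [Ef ab]]]].
have [u [v [Eg uv _]]] := cycle_edges_connect cyc g_c.
exists a, b, g; rewrite -Ef; split=> //.
  by move: uv; rewrite /adj_of -Eg in_setU1 (negbTE gf) => /andP[].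
have /spanning_treeP[_ _ /(_ a b)] := sT'.
have nab : a != b by apply: contraTneq ab => ->; rewrite e_irr.
rewrite ET' -Ef (_ : _ :\ g :\ f = T :\ g); first apply.
  by rewrite adjD1 -Ef /adj_of nab -Ef setU11 eq_sym.
apply/setP => h; rewrite !inE; case: eqP => //= ->.
by rewrite (negbTE fT) andbF.
Qed.

End Exchange.
End Trees.

(** * Distances and couplings *)

Section Distance.
Variables (V : finType) (e : rel V).

Lemma gdist_le u p : path e u p -> (gdist e u (last u p) <= size p)%N.
Proof.
move=> pth; rewrite leqNgt; apply/negP => lt.
have szV : (size p < #|V|)%N.
  by apply: leq_trans lt _; rewrite -[X in (_ <= X)%N](size_iota 0) find_size.
have := before_find 0%N lt; rewrite nth_iota // => /negbT/negP; apply.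
by apply/existsP; exists (in_tuple p); rewrite /= pth eqxx.
Qed.

Lemma gdist_path u v : connect e u v ->
  exists p, [/\ path e u p, last u p = v & size p = gdist e u v].
Proof.
case/connectP=> p0 pth0 lst0; move: pth0 lst0; case/shortenP=> p pth unq _ lst {p0}.
have szp : (size p < #|V|)%N.
  by have := max_card (mem (u :: p)); rewrite (card_uniqP unq).
have hs : has (fun n => [exists p : n.-tuple V, path e u p && (last u p == v)]) (iota 0 #|V|).
  apply/hasP; exists (size p); first by rewrite mem_iota.
  by apply/existsP; exists (in_tuple p); rewrite /= pth lst eqxx.
have := nth_find 0%N hs; rewrite nth_iota; last by move: hs; rewrite has_find size_iota.
case/existsP=> q /andP[qp /eqP ql]; exists q; split=> //.
by rewrite size_tuple.
Qed.

Lemma gdist0 u : gdist e u u = 0%N.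
Proof. by apply/eqP; rewrite -leqn0; apply: (@gdist_le u [::]). Qed.

Lemma gdist_triangle u v w : connect e u v -> connect e v w ->
  (gdist e u w <= gdist e u v + gdist e v w)%N.
Proof.
move=> /gdist_path[p [pp <- <-]] /gdist_path[q [qp <- <-]].
by rewrite -size_cat -last_cat; apply: gdist_le; rewrite cat_path pp.
Qed.

Lemma gdist_sym_le u v : symmetric e -> connect e u v -> (gdist e v u <= gdist e u v)%N.
Proof.
move=> sym /gdist_path[p [pp <- <-]].
rewrite -(size_belast u p) -size_rev.
have := @gdist_le (last u p) (rev (belast u p)).
have pr : path e (last u p) (rev (belast u p)).
  by rewrite rev_path (eq_path (e' := e)).
move/(_ pr).
by case: p {pp pr} => //= w p; rewrite rev_cons last_rcons.
Qed.

Lemma gdist_sym u v : symmetric e -> connect e u v -> gdist e u v = gdist e v u.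
Proof.
move=> sym uv; apply/eqP; rewrite eqn_leq !gdist_sym_le //.
by rewrite (sym_connect_sym sym).
Qed.

Lemma gdist_adj u v : e u v -> (gdist e u v <= 1)%N.
Proof. by move=> uv; apply: (@gdist_le u [:: v]); rewrite /= uv. Qed.

Lemma gdist_lipschitz (R : realType) (f : V -> R) u v : connect e u v ->
  (forall a b, e a b -> f a - f b <= 1) -> f u - f v <= (gdist e u v)%:R.
Proof.
move=> /gdist_path[p [pp <- <-]] lip; elim: p u pp => [|w p IH] u /=.
  by rewrite subrr.
case/andP=> /lip uw /IH; rewrite -natr1; lra.
Qed.

End Distance.

Section Couplings.
Variables (R : realType) (V : finType).
Implicit Types (d pi : V -> V -> R) (mu nu f s : V -> R).

Definition transport_cost d pi : R := \sum_u \sum_v pi u v * d u v.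

Lemma wasserstein_min (h : rel V) mu nu c :
  (exists2 pi, coupling mu nu pi &
     transport_cost (fun u v => (gdist h u v)%:R) pi <= c) ->
  (forall pi, coupling mu nu pi ->
     c <= transport_cost (fun u v => (gdist h u v)%:R) pi) ->
  wasserstein h mu nu = c.
Proof.
move=> [pi cpl le_c] ge_c; rewrite /wasserstein; set S := (X in inf X).
have Sc : S c.
  by exists pi => //; apply/eqP; rewrite eq_le le_c ge_c.
apply/eqP; rewrite eq_le; apply/andP; split.
  by apply: ge_inf Sc; exists c => _ [pi' + ->]; apply: ge_c.
by apply: lb_le_inf; [exists c | move=> _ [pi' + ->]; apply: ge_c].
Qed.

(** Kantorovich duality, easy half. *)
Lemma coupling_dual d mu nu pi f : coupling mu nu pi ->
  (forall u v, f u - f v <= d u v) ->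
  \sum_u f u * (mu u - nu u) <= transport_cost d pi.
Proof.
case=> pi0 row col lip.
have -> : \sum_u f u * (mu u - nu u) = \sum_u \sum_v pi u v * (f u - f v).
  under eq_bigr do rewrite mulrBr.
  rewrite sumrB; under [RHS]eq_bigr do under eq_bigr do rewrite mulrBr.
  under [RHS]eq_bigr do rewrite sumrB.
  rewrite sumrB; congr (_ - _); last rewrite exchange_big /=.
    by apply: eq_bigr => u _; rewrite -row mulrC mulr_suml.
  by apply: eq_bigr => u _; rewrite -col mulrC mulr_suml.
by apply: ler_sum => u _; apply: ler_sum => v _; apply: ler_wpM2l.
Qed.

Lemma sum_delta (p : V) (F : V -> R) : \sum_u (u == p)%:R * F u = F p.
Proof.
rewrite (bigD1 p) //= eqxx mul1r big1 ?addr0 // => u /negbTE ->.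
by rewrite mul0r.
Qed.

Lemma sum_indicator (p : V) : \sum_u (u == p)%:R = 1 :> R.
Proof. by rewrite -[RHS](sum_delta p (fun=> 1)); apply: eq_bigr => u _; rewrite mulr1. Qed.

(** Moving mass delta from v to its neighbour p costs at most delta * d v p on
    top of the remaining transport: redirect the fraction delta / mu p of what
    leaves p. *)
Lemma coupling_shift d mu nu pi (v p : V) (delta : R) :
  (forall w, d v w <= d v p + d p w) ->
  coupling mu nu pi -> 0 <= delta <= mu p -> v != p ->
  exists2 pi', coupling (fun u => mu u + delta * (u == v)%:R - delta * (u == p)%:R) nu pi' &
    transport_cost d pi' <= transport_cost d pi + delta * d v p.
Proof.
move=> tri [pi0 row col] /andP[d0 dp] vp.
pose k := delta / mu p.
have k0 : 0 <= k by rewrite divr_ge0 // (le_trans d0).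
have kp : k * mu p = delta.
  have [mp0|mpn0] := eqVneq (mu p) 0; last by rewrite divfK.
  by rewrite mp0 mulr0; rewrite mp0 in dp; apply/eqP; rewrite eq_le d0 dp.
have k1 : k <= 1.
  have [mp0|mpn0] := eqVneq (mu p) 0; first by rewrite /k mp0 invr0 mulr0 ler01.
  by rewrite ler_pdivrMr ?mul1r // lt_def mpn0 (le_trans d0).
exists (fun u w => pi u w + k * pi p w * ((u == v)%:R - (u == p)%:R)).
  split=> [u w|u|w].
  - case: (eqVneq u p) => [->|up] /=.
      rewrite eq_sym (negbTE vp) /= sub0r mulrN1 subr_ge0.
      exact: ler_piMl (pi0 p w) k1.
    by rewrite subr0 addr_ge0 // mulr_ge0 ?ler0n // mulr_ge0.
  - by rewrite /= big_split /= row -mulr_suml -mulr_sumr row kp mulrBr addrA.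
  rewrite /= big_split /= col -mulr_sumr sumrB.
  by rewrite !sum_indicator subrr mulr0 addr0.
rewrite /transport_cost.
have -> : \sum_u \sum_w (pi u w + k * pi p w * ((u == v)%:R - (u == p)%:R)) * d u w =
   \sum_u \sum_w pi u w * d u w + \sum_w k * pi p w * (d v w - d p w).
  under eq_bigr do under eq_bigr do rewrite mulrDl.
  under eq_bigr do rewrite big_split /=.
  rewrite big_split /=; congr (_ + _); rewrite exchange_big /=.
  apply: eq_bigr => w _.
  under eq_bigr do rewrite -mulrA mulrBl.
  by rewrite -mulr_sumr sumrB !(sum_delta _ (fun u => d u w)).
rewrite lerD2l -kp -row mulr_sumr mulr_suml.
apply: ler_sum => w _; apply: ler_wpM2l; first by rewrite mulr_ge0.
by rewrite lerBlDr.
Qed.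

Lemma coupling_transpose d mu nu pi : (forall u v, d u v = d v u) ->
  coupling mu nu pi ->
  coupling nu mu (fun u v => pi v u) /\
  transport_cost d (fun u v => pi v u) = transport_cost d pi.
Proof.
move=> sym [pi0 row col]; split; first by split.
rewrite /transport_cost exchange_big /=.
by apply: eq_bigr => u _; apply: eq_bigr => v _; rewrite sym.
Qed.

Lemma coupling_ext mu mu' nu pi : mu =1 mu' -> coupling mu nu pi -> coupling mu' nu pi.
Proof. by move=> E [pi0 row col]; split=> // u; rewrite -E. Qed.

Lemma coupling_diag d mu nu : (forall u, d u u = 0) -> (forall u, 0 <= mu u) ->
  mu =1 nu -> exists2 pi, coupling mu nu pi & transport_cost d pi = 0.
Proof.
move=> d0 mu0 E; exists (fun u v => (v == u)%:R * mu v).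
  split=> [u v|u|v]; first by rewrite mulr_ge0 ?ler0n.
    by rewrite (sum_delta u mu).
  rewrite -E -mulr_suml.
  have -> : \sum_u (v == u)%:R = 1 :> R; last by rewrite mul1r.
  by rewrite (bigD1 v) //= eqxx big1 ?addr0 // => u; rewrite eq_sym => /negbTE ->.
rewrite /transport_cost big1 // => u _; rewrite big1 // => v _.
by case: eqP => [->|]; rewrite ?d0 ?mulr0 // !mul0r.
Qed.

End Couplings.

(** * Rooted trees *)

Section Rooted.
Variables (V : finType).
Implicit Types (T : {set {set V}}) (par : V -> V) (dep : V -> nat) (ord : seq V).

(** An enumeration in which every vertex but r precedes its parent, and r
    comes last. *)
Fixpoint leaves_first par (r : V) ord : bool :=
  if ord is v :: ord' then
    [&& v \notin ord', if v == r then ord' == [::] else par v \in ord'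
      & leaves_first par r ord']
  else true.

Record rooted T (r : V) par dep ord : Prop := Rooted {
  par_root : par r = r;
  dep_root : dep r = 0%N;
  par_edge : forall v, v != r -> adj_of T v (par v);
  dep_par : forall v, v != r -> dep v = (dep (par v)).+1;
  par_adj : forall u w, adj_of T u w ->
    (u != r /\ w = par u) \/ (w != r /\ u = par w);
  ord_leaves_first : leaves_first par r ord;
  ord_all : forall v, v \in ord }.

Lemma leaves_first_par par r ord v : par r = r -> leaves_first par r ord ->
  v \in ord -> par v \in ord.
Proof.
move=> parr; elim: ord => //= w ord IH /and3P[_ parw lf].
rewrite !inE => /predU1P[->|/(IH lf) ->]; last by rewrite orbT.
by case: eqP parw => [->|_ ->]; rewrite ?parr ?eqxx ?orbT.
Qed.

Lemma leaves_first_uniq par r ord : leaves_first par r ord -> uniq ord.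
Proof. by elim: ord => //= w ord IH /and3P[-> _ /IH]. Qed.

Section Sums.
Variables (R : realType) (par : V -> V) (r : V).
Hypothesis par_r : par r = r.
Notation sums ord s := (subtree_sums par r ord s).1.

Lemma subtree_sums_time ord (s : V -> R) :
  (subtree_sums par r ord s).2 = (size ord).+1.
Proof. by elim: ord s => //= v ord IH s; rewrite IH. Qed.

Lemma sums_not_parent ord (s : V -> R) u :
  (forall v, v \in ord -> v != r -> par v != u) -> sums ord s u = s u.
Proof.
elim: ord s => //= v ord IH s np; rewrite IH; last first.
  by move=> w w_o; apply: np; rewrite inE w_o orbT.
case: (eqVneq v r) => // vr; rewrite /upd eq_sym.
by rewrite (negbTE (np v (mem_head _ _) vr)).
Qed.

(** When v is processed, all its children have been. *)
Lemma sums_head v ord (s : V -> R) : leaves_first par r (v :: ord) ->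
  sums (v :: ord) s v = s v.
Proof.
move=> /= /and3P[nv parv lf].
have npar u : u \in ord -> par u != v.
  by move=> /(leaves_first_par par_r lf); apply: contraTneq => ->.
rewrite sums_not_parent => [|u /npar //].
case: (eqVneq v r) parv => // vr parv; rewrite /upd.
by case: eqP parv nv => // <- ->.
Qed.

(** Conservation: what leaves u towards the root is its own mass and what its
    children send. *)
Lemma sums_eq ord (s : V -> R) u : leaves_first par r ord ->
  sums ord s u = s u + \sum_(v <- ord | (v != r) && (par v == u)) sums ord s v.
Proof.
elim: ord s => [|v ord IH] s lf; first by rewrite big_nil addr0.
rewrite big_cons (sums_head _ lf).
have /= /and3P[nv parv lf'] := lf; rewrite IH //.
case: (eqVneq v r) => //= vr; rewrite {1}/upd eq_sym.
by case: eqP => // ->; rewrite addrA.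
Qed.

(** Processing the leaves first, each non-root vertex v passes its excess
    mu v - nu v to its parent, at cost |excess|. *)
Lemma sums_coupling (d : V -> V -> R) ord (s mu nu : V -> R) :
  (forall u, d u u = 0) -> (forall u v, d u v = d v u) ->
  (forall u v w, d u w <= d u v + d v w) ->
  (forall v, v != r -> d v (par v) <= 1) ->
  leaves_first par r ord -> (forall u, 0 <= mu u) -> (forall u, 0 <= nu u) ->
  (forall u, mu u - nu u = if u \in ord then s u else 0) ->
  \sum_u mu u = \sum_u nu u ->
  exists2 pi, coupling mu nu pi &
    transport_cost d pi <= \sum_(v <- ord | v != r) `|sums ord s v|.
Proof.
move=> d0 sym tri d1.
elim: ord s mu nu => [|v ord IH] s mu nu lf mu0 nu0 Es Em.
  have [|pi cpl cost] := coupling_diag d0 mu0 (_ : mu =1 nu).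
    by move=> u; apply/eqP; rewrite -subr_eq0 Es.
  by exists pi; rewrite // cost big_nil.
rewrite big_cons (sums_head _ lf).
have /= /and3P[nv parv lf'] := lf.
case: (eqVneq v r) parv => [vr /eqP o0|vr parv] /=.
  have : \sum_u (mu u - nu u) = 0 by rewrite sumrB Em subrr.
  rewrite (bigD1 v) //= big1 ?addr0 => [Ev|u uv]; last first.
    by rewrite Es o0 inE (negbTE uv).
  have [|pi cpl cost] := coupling_diag d0 mu0 (_ : mu =1 nu).
    move=> u; apply/eqP; rewrite -subr_eq0; case: (eqVneq u v) => [->|uv].
      by rewrite Ev.
    by rewrite Es o0 inE (negbTE uv).
  by exists pi; rewrite // cost o0 big_nil.
set p := par v; set s1 := upd s p (s p + s v).
have vp : v != p by apply: contraNneq nv => ->.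
have Esv : mu v - nu v = s v by rewrite Es mem_head.
have Es1 u : (mu u - nu u) + s v * (u == p)%:R - s v * (u == v)%:R =
    if u \in ord then s1 u else 0.
  rewrite Es inE /s1 /upd; case: (eqVneq u v) => [->|uv] /=.
    by rewrite (negbTE nv) (negbTE vp) /=; ring.
  by case: (eqVneq u p) => [->|up] /=; [rewrite parv|case: ifP => _]; ring.
have [sv0|/ltW sv0] := lerP 0 (s v).
  pose mu' u := mu u + s v * (u == p)%:R - s v * (u == v)%:R.
  have mu'0 u : 0 <= mu' u.
    rewrite /mu'; case: (eqVneq u v) => [->|uv] /=.
      by rewrite (negbTE vp) /=; have := nu0 v; lra.
    by rewrite mulr0 subr0 addr_ge0 // mulr_ge0.
  have [||pi cpl cost] := IH s1 mu' nu lf' mu'0 nu0.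
  - by move=> u; rewrite -Es1 /mu'; ring.
  - by rewrite /mu' sumrB big_split /= Em -!mulr_sumr !sum_indicator; ring.
  have [|pi' cpl' cost'] := coupling_shift (delta := s v) (tri v p) cpl _ vp.
    by rewrite sv0 /mu' eqxx eq_sym (negbTE vp) /=; have := mu0 p; lra.
  exists pi'; first by apply: coupling_ext cpl' => u; rewrite /mu'; ring.
  rewrite (le_trans cost') // addrC lerD // ger0_norm //.
  by rewrite -[leRHS]mulr1 ler_wpM2l // d1.
pose nu' u := nu u - s v * (u == p)%:R + s v * (u == v)%:R.
have nu'0 u : 0 <= nu' u.
  rewrite /nu'; case: (eqVneq u v) => [->|uv] /=.
    by rewrite (negbTE vp) /=; have := mu0 v; lra.
  rewrite mulr0 addr0; case: eqP => _; rewrite ?mulr0 ?subr0 // mulr1.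
  by have := nu0 u; lra.
have [||pi cpl cost] := IH s1 mu nu' lf' mu0 nu'0.
- by move=> u; rewrite -Es1 /nu'; ring.
- by rewrite /nu' big_split sumrB /= Em -!mulr_sumr !sum_indicator; ring.
have [cplT costT] := coupling_transpose sym cpl.
have [|pi' cpl' cost'] := coupling_shift (delta := - s v) (tri v p) cplT _ vp.
  by rewrite oppr_ge0 sv0 /nu' eqxx eq_sym (negbTE vp) /=; have := nu0 p; lra.
have [cpl2 cost2] := coupling_transpose sym cpl'.
exists (fun u w => pi' w u).
  case: cpl2 => pi0 row col; split=> // u; rewrite col /nu'; ring.
rewrite cost2 (le_trans cost') // addrC lerD ?costT // ler0_norm //.
by rewrite -[leRHS]mulr1 ler_wpM2l ?oppr_ge0 // d1.
Qed.

End Sums.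
End Rooted.

(** * Transport on a rooted tree *)

Section TreeCost.
Variables (R : realType) (V : finType) (T : {set {set V}}) (r : V).
Variables (par : V -> V) (dep : V -> nat) (ord : seq V).
Hypothesis rT : rooted T r par dep ord.
Implicit Types (f s h mass mu nu : V -> R) (phi : V -> V -> R).

Let par_r := par_root rT.
Let lf := ord_leaves_first rT.

Lemma dep_lt v : v != r -> (dep (par v) < dep v)%N.
Proof. by move=> vr; rewrite (dep_par rT vr). Qed.

Lemma rooted_ind (P : V -> Prop) :
  P r -> (forall v, v != r -> P (par v) -> P v) -> forall v, P v.
Proof.
move=> Pr Pv v; have [n] := ubnP (dep v); elim: n v => // n IH v dn.
have [->//|vr] := eqVneq v r.
by apply: Pv => //; apply: IH; apply: leq_trans (dep_lt vr) _.
Qed.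

Lemma dep_eq0 v : dep v = 0%N -> v = r.
Proof. by move=> d0; apply/eqP; apply: contraT => /dep_lt; rewrite d0. Qed.

Lemma rooted_connect_root v : connect (adj_of T) v r.
Proof.
elim/rooted_ind: v => [|v vr]; first exact: connect0.
by apply: connect_trans; apply/connect1/(par_edge rT vr).
Qed.

Lemma rooted_connected : connected (adj_of T).
Proof.
move=> u v; apply: connect_trans (rooted_connect_root u) _.
by rewrite connect_adj_sym rooted_connect_root.
Qed.

Lemma big_ord_list (F : V -> R) : \sum_(v <- ord | v != r) F v = \sum_(v | v != r) F v.
Proof.
apply: perm_big; apply: uniq_perm; rewrite ?index_enum_uniq //.
  exact: leaves_first_uniq lf.
by move=> v; rewrite mem_index_enum (ord_all rT).
Qed.

(** The function which grows by c v along each tree edge from par v to v. *)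
Definition potential (c : V -> R) (v : V) : R := \sum_(i < dep v) c (iter i par v).

Lemma potential_par c v : v != r -> potential c v = c v + potential c (par v).
Proof.
move=> vr; rewrite /potential (dep_par rT vr) big_ord_recl; congr (_ + _).
by apply: eq_bigr => i _; rewrite /= -iterSr.
Qed.

Lemma potential_lipschitz c u v : (forall v, `|c v| <= 1) ->
  potential c u - potential c v <= (gdist (adj_of T) u v)%:R.
Proof.
move=> c1; apply: gdist_lipschitz; first exact: rooted_connected.
move=> a b /(par_adj rT)[[ar ->]|[br ->]].
  by rewrite (potential_par _ ar); have := c1 a; rewrite ler_norml => /andP[]; lra.
by rewrite (potential_par _ br); have := c1 b; rewrite ler_norml => /andP[]; lra.
Qed.

Lemma normr_sg_le1 (x : R) : `|Num.sg x| <= 1.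
Proof. by rewrite normr_sg lern1; case: (x != 0). Qed.

Definition is_flow mass phi :=
  [/\ forall u w, phi u w = - phi w u, forall u w, ~~ adj_of T u w -> phi u w = 0 &
      forall u, \sum_w phi u w = mass u].

Definition flow_cost phi : R := \sum_u \sum_w `|phi u w|.

(** Summation by parts. *)
Lemma flow_potential mass phi f : is_flow mass phi ->
  \sum_u \sum_w phi u w * (f u - f w) = (\sum_u f u * mass u) *+ 2.
Proof.
case=> anti _ div.
under eq_bigr do under eq_bigr do rewrite mulrBr.
under eq_bigr do rewrite sumrB.
rewrite sumrB mulr2n -[X in _ = X + _]opprK -[X in _ = - X + _]sumrN.
have E1 : \sum_u \sum_w phi u w * f u = \sum_u f u * mass u.
  by apply: eq_bigr => u _; rewrite -mulr_suml div mulrC.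
have E2 : \sum_u \sum_w phi u w * f w = - \sum_u f u * mass u.
  rewrite exchange_big /= -sumrN; apply: eq_bigr => u _.
  by rewrite -mulr_suml -(div u) -mulrN -sumrN mulrC; congr (_ * _); apply: eq_bigr => w _.
by rewrite E1 E2 sumrN opprK.
Qed.

Lemma flow_potential_le mass phi f : is_flow mass phi ->
  (forall u w, adj_of T u w -> f u - f w <= 1) ->
  (\sum_u f u * mass u) *+ 2 <= flow_cost phi.
Proof.
move=> fl lip; rewrite -(flow_potential _ fl); case: fl => anti supp _.
apply: ler_sum => u _; apply: ler_sum => w _.
case: (boolP (adj_of T u w)) => [uw|/supp ->]; last by rewrite mul0r normr0.
rewrite -[leRHS]mulr1; have := lip _ _ uw; rewrite adj_sym in uw; have := lip _ _ uw.
move=> l1 l2; apply: le_trans (ler_norm _) _; rewrite normrM ler_wpM2l //.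
by rewrite ler_norml; apply/andP; split; lra.
Qed.

(** The increments of the potential are the signs of phi, so the bound
    [flow_potential_le] is tight. *)
Lemma flow_potential_eq mass phi : is_flow mass phi ->
  let f := potential (fun v => Num.sg (phi v (par v))) in
  flow_cost phi = (\sum_u f u * mass u) *+ 2.
Proof.
move=> fl f; rewrite -(flow_potential _ fl); case: fl => anti supp _.
apply: eq_bigr => u _; apply: eq_bigr => w _.
case: (boolP (adj_of T u w)) => [|/supp ->]; last by rewrite mul0r normr0.
case/(par_adj rT) => [[ur ->]|[wr ->]]; rewrite /f.
  by rewrite (potential_par _ ur) addrK mulrC -normrEsg.
by rewrite (potential_par _ wr) opprD addrCA subrr addr0 anti mulrNN normrN mulrC -normrEsg.
Qed.

Lemma sg_potential_adj c u w : (forall v, `|c v| <= 1) ->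
  adj_of T u w -> potential c u - potential c w <= 1.
Proof.
move=> c1 uw; apply: le_trans (potential_lipschitz u w c1) _.
by rewrite lern1 gdist_adj.
Qed.

(** The potential that is tight for one flow bounds the cost of the other. *)
Lemma flow_cost_unique mass phi psi : is_flow mass phi -> is_flow mass psi ->
  flow_cost phi = flow_cost psi.
Proof.
have le_cost phi' psi' : is_flow mass phi' -> is_flow mass psi' ->
    flow_cost phi' <= flow_cost psi'.
  move=> fl1 fl2; rewrite (flow_potential_eq fl1); apply: flow_potential_le fl2 _.
  by move=> u w; apply: sg_potential_adj => v; apply: normr_sg_le1.
by move=> fl1 fl2; apply/eqP; rewrite eq_le !le_cost.
Qed.

(** Each non-root vertex v sends h v to its parent. *)
Definition up_flow h (u w : V) : R :=
  (if (u != r) && (par u == w) then h u else 0) -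
  (if (w != r) && (par w == u) then h w else 0).

Lemma up_flow_anti h u w : up_flow h u w = - up_flow h w u.
Proof. by rewrite /up_flow opprB. Qed.

Lemma up_flow_supp h u w : ~~ adj_of T u w -> up_flow h u w = 0.
Proof.
move=> nuw; rewrite /up_flow; case: ifP => [/andP[ur /eqP E]|_].
  by rewrite -E (par_edge rT ur) in nuw.
case: ifP => [/andP[wr /eqP E]|_]; last by rewrite subr0.
by rewrite adj_sym -E (par_edge rT wr) in nuw.
Qed.

Lemma sum_if_eq (b : bool) (p : V) (c : R) :
  \sum_w (if b && (p == w) then c else 0) = if b then c else 0.
Proof.
case: b => /=; last by rewrite big1.
by rewrite -big_mkcond /= (eq_bigl (pred1 p)) ?big_pred1_eq // => w; rewrite eq_sym.
Qed.

Lemma up_flow_div h u :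
  \sum_w up_flow h u w =
    (if u != r then h u else 0) - \sum_(w | (w != r) && (par w == u)) h w.
Proof.
by rewrite sumrB sum_if_eq [RHS]/=; congr (_ - _); rewrite -big_mkcond.
Qed.

Lemma par_par u : u != r -> par u != r -> par (par u) != u.
Proof.
move=> ur pr; apply/eqP => E.
by have := dep_lt ur; have := dep_lt pr; rewrite E; lia.
Qed.

Lemma up_flow_norm h u w : `|up_flow h u w| =
  (if (u != r) && (par u == w) then `|h u| else 0) +
  (if (w != r) && (par w == u) then `|h w| else 0).
Proof.
rewrite /up_flow; case: ifP => [/andP[ur /eqP E]|_]; last first.
  by case: ifP => _; rewrite sub0r add0r normrN // normr0.
suff /negbTE -> : ~~ ((w != r) && (par w == u)) by rewrite subr0 addr0.
by rewrite -E; apply/negP => /andP[pr]; apply/negP/par_par.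
Qed.

Lemma up_flow_cost h : flow_cost (up_flow h) = (\sum_(v | v != r) `|h v|) *+ 2.
Proof.
rewrite /flow_cost; under eq_bigr do under eq_bigr do rewrite up_flow_norm.
under eq_bigr do rewrite big_split /=.
have E : \sum_u \sum_w (if (u != r) && (par u == w) then `|h u| else 0) =
    \sum_(v | v != r) `|h v|.
  by rewrite [RHS]big_mkcond /=; apply: eq_bigr => u _; rewrite sum_if_eq.
by rewrite big_split /= E [X in _ + X]exchange_big /= E mulr2n.
Qed.

Notation sums mass := (subtree_sums par r ord mass).1.

Lemma sumsE mass u :
  sums mass u = mass u + \sum_(v | (v != r) && (par v == u)) sums mass v.
Proof.
rewrite (sums_eq par_r _ _ lf); congr (_ + _).
rewrite -big_filter_cond -[RHS]big_filter_cond !big_filter_cond.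
apply: perm_big; apply: uniq_perm; rewrite ?index_enum_uniq //.
  exact: leaves_first_uniq lf.
by move=> v; rewrite mem_index_enum (ord_all rT).
Qed.

Lemma sums_root mass : \sum_u mass u = 0 -> sums mass r = 0.
Proof.
move=> tot0; have : \sum_u sums mass u =
    \sum_u mass u + \sum_u \sum_(v | (v != r) && (par v == u)) sums mass v.
  by rewrite -big_split; apply: eq_bigr => u _; exact: sumsE.
have -> : \sum_u \sum_(v | (v != r) && (par v == u)) sums mass v =
    \sum_(v | v != r) sums mass v.
  rewrite (exchange_big_dep (fun v => v != r)) /=; last by move=> u v _ /andP[].
  apply: eq_bigr => v vr; rewrite (eq_bigl (pred1 (par v))) ?big_pred1_eq // => u.
  by rewrite vr eq_sym.
rewrite tot0 add0r (bigD1 r) //= => /eqP.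
by rewrite -subr_eq0 addrK => /eqP.
Qed.

Lemma sums_flow mass : \sum_u mass u = 0 -> is_flow mass (up_flow (sums mass)).
Proof.
move=> tot0; split; [exact: up_flow_anti|exact: up_flow_supp|move=> u].
rewrite up_flow_div; have := sumsE mass u.
by case: eqVneq => [->|_] /=; rewrite ?(sums_root tot0); move: (\sum_(w | _) _) => S; lra.
Qed.

(** Shipping everything towards the root is a
    coupling of cost sum |s v|, and the potential following the signs of s
    certifies that no coupling is cheaper. *)
Lemma tree_wasserstein mu nu : (forall u, 0 <= mu u) -> (forall u, 0 <= nu u) ->
  \sum_u mu u = \sum_u nu u ->
  wasserstein (adj_of T) mu nu =
    \sum_(v | v != r) `|sums (fun u => mu u - nu u) v|.
Proof.
move=> mu0 nu0 tot; set mass := fun u => mu u - nu u.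
have tot0 : \sum_u mass u = 0 by rewrite sumrB tot subrr.
have con := rooted_connected.
apply: wasserstein_min.
  rewrite -big_ord_list; apply: sums_coupling => //.
  - by move=> u; rewrite gdist0.
  - by move=> u v; rewrite gdist_sym // => ? ?; apply: adj_sym.
  - by move=> u v w; rewrite -natrD ler_nat gdist_triangle.
  - by move=> v vr; rewrite lern1 gdist_adj // (par_edge rT).
  by move=> u; rewrite (ord_all rT).
move=> pi cpl; have fl := sums_flow tot0.
have := flow_potential_eq fl; rewrite up_flow_cost /=.
set A := \sum_(v | _) _; set B := \sum_u _ => E; have -> : A = B by lra.
apply: coupling_dual cpl _ => u v; apply: potential_lipschitz => w.
exact: normr_sg_le1.
Qed.

Lemma tree_wasserstein_flow mu nu phi : (forall u, 0 <= mu u) -> (forall u, 0 <= nu u) ->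
  \sum_u mu u = \sum_u nu u -> is_flow (fun u => mu u - nu u) phi ->
  flow_cost phi = wasserstein (adj_of T) mu nu *+ 2.
Proof.
move=> mu0 nu0 tot fl; rewrite tree_wasserstein // -up_flow_cost.
apply: flow_cost_unique fl (sums_flow _).
by rewrite sumrB tot subrr.
Qed.

(** * Descendants and separating edges *)

Definition anc (v u : V) : bool := fconnect par u v.

Lemma anc_step v u : anc v u = (u == v) || anc v (par u).
Proof. exact: fconnect_eqVf. Qed.

Lemma anc_dep v u : anc v u -> (dep v <= dep u)%N.
Proof.
case/iter_findex => <-; elim: (findex _ _ _) => //= n; apply: leq_trans.
set w := iter _ _ _; case: (eqVneq w r) => [->|/dep_lt/ltnW//].
by rewrite par_r.
Qed.

Lemma anc_refl v : anc v v.
Proof. exact: connect0. Qed.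

Lemma anc_root_only v : v != r -> ~~ anc v r.
Proof.
by move=> vr; apply/negP => /anc_dep; rewrite (dep_root rT) leqn0 => /eqP/dep_eq0/eqP; rewrite (negbTE vr).
Qed.

Lemma anc_par v : v != r -> ~~ anc v (par v).
Proof. by move=> vr; apply/negP => /anc_dep; rewrite leqNgt dep_lt. Qed.

Lemma anc_root u : anc r u.
Proof.
elim/rooted_ind: u => [|u _ IH]; first exact: anc_refl.
by rewrite anc_step IH orbT.
Qed.

(** Deleting the edge {v, par v} cuts off the descendants of v from the rest:
    the former still reach v by climbing and the latter still reach r. *)
Lemma anc_connect v a b : v != r ->
  connect (adj_of (T :\ [set v; par v])) a b = (anc v a == anc v b).
Proof.
move=> vr; set T' := T :\ _.
have up u : u != r -> u != v -> adj_of T' u (par u).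
  move=> ur uv; rewrite adjD1 (par_edge rT ur) /=.
  apply/eqP => /set2_inj[[/eqP]|[E1 E2]]; first by rewrite (negbTE uv).
  by have := dep_lt ur; have := dep_lt vr; rewrite E2 -E1; lia.
have desc u : anc v u -> connect (adj_of T') u v.
  elim/rooted_ind: u => [|u ur IH]; first by rewrite (negbTE (anc_root_only vr)).
  have [->|uv] := eqVneq u v; first by rewrite connect0.
  rewrite anc_step (negbTE uv) /= => /IH; apply: connect_trans.
  by apply/connect1/up.
have others u : ~~ anc v u -> connect (adj_of T') u r.
  elim/rooted_ind: u => [|u ur IH]; first by rewrite connect0.
  rewrite anc_step negb_or => /andP[uv /IH]; apply: connect_trans.
  by apply/connect1/up.
have sym := connect_adj_sym T'.
apply/idP/eqP => [|E].
  move=> con; apply/(closed_connect (a := anc v)): con.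
  move=> u w; rewrite adjD1 => /andP[/(par_adj rT) uw nE]; move: uw nE.
  case=> [[ur ->]|[wr ->]] nE.
    rewrite -!topredE /= (anc_step v u); case: (eqVneq u v) nE => [->|//].
    by rewrite eqxx.
  rewrite -!topredE /= (anc_step v w); case: (eqVneq w v) nE => [->|//].
  by rewrite setUC eqxx.
case: (boolP (anc v a)) E => [da /esym /desc db|na /esym/negbT /others nb].
  by apply: connect_trans (desc _ da) _; rewrite sym.
by apply: connect_trans (others _ na) _; rewrite sym.
Qed.

Definition separates (a b v : V) : bool := anc v a != anc v b.

Lemma separates_root a b : ~~ separates a b r.
Proof. by rewrite /separates !anc_root. Qed.

(** On the path from a to b, +1 for the edges climbed on the side of a, -1 for
    those descended on the side of b, and 0 off the path. *)
Definition side (a b v : V) : R := (anc v a)%:R - (anc v b)%:R.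

(** The unit flow from a up to the root. *)
Lemma up_flow_anc_div a u :
  \sum_w up_flow (fun v => (anc v a)%:R) u w = (u == a)%:R - (u == r)%:R.
Proof.
elim/rooted_ind: a => [|a ar IH].
  rewrite up_flow_div subrr big1 => [|w /andP[wr _]].
    by case: ifP => // ur; rewrite ?(negbTE (anc_root_only ur)) subr0.
  by rewrite (negbTE (anc_root_only wr)).
have E v : (anc v a)%:R = (anc v (par a))%:R + (v == a)%:R :> R.
  rewrite anc_step eq_sym; case: eqVneq => [->|_] /=; last by rewrite addr0.
  by rewrite (negbTE (anc_par ar)) add0r.
have -> : \sum_w up_flow (fun v => (anc v a)%:R) u w =
    \sum_w up_flow (fun v => (anc v (par a))%:R) u w + \sum_w up_flow (fun v => (v == a)%:R) u w.
  rewrite -big_split; apply: eq_bigr => w _ /=.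
  by rewrite /up_flow !E; do 2![case: ifP => _]; ring.
rewrite IH up_flow_div.
have -> : (if u != r then (u == a)%:R else 0 : R) = (u == a)%:R.
  by case: eqVneq => //= ->; rewrite eq_sym (negbTE ar).
have -> : \sum_(w | (w != r) && (par w == u)) (w == a)%:R = (u == par a)%:R :> R.
  rewrite big_mkcond /= (bigD1 a) //= ar eqxx /= [u == _]eq_sym big1 ?addr0; first by case: eqP.
  by move=> w /negbTE ->; case: ifP.
lra.
Qed.

End TreeCost.

(** * The cost after an exchange *)

Section ExchangeCost.
Variables (R : realType) (V : finType) (T : {set {set V}}) (r : V).
Variables (par : V -> V) (dep : V -> nat) (ord : seq V).
Hypothesis rT : rooted T r par dep ord.
Variables (mu nu : V -> R).
Hypotheses (mu0 : forall u, 0 <= mu u) (nu0 : forall u, 0 <= nu u).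
Hypothesis tot : \sum_u mu u = \sum_u nu u.

Let s := (subtree_sums par r ord (fun u => mu u - nu u)).1.

Lemma side_sqr a b v : separates par a b v -> side R par a b v * side R par a b v = 1.
Proof.
by rewrite /separates /side; do 2![case: (anc _ _ _)] => //= _; ring.
Qed.

Lemma side_norm a b v : separates par a b v -> `|side R par a b v| = 1.
Proof.
by rewrite /separates /side; do 2![case: (anc _ _ _)] => //= _;
  rewrite ?subr0 ?sub0r ?normrN normr1.
Qed.

Lemma side_eq0 a b v : ~~ separates par a b v -> side R par a b v = 0.
Proof. by rewrite /separates negbK /side => /eqP ->; rewrite subrr. Qed.

Lemma sum_indicator2 (a b : V) : \sum_u \sum_w ((u == a) && (w == b))%:R = 1 :> R.
Proof.
rewrite -[RHS](sum_indicator R a); apply: eq_bigr => u _.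
case: (u == a) => /=; last by rewrite big1.
exact: (sum_indicator R b).
Qed.

(** Sending t along f from a to b and back along the tree path from b to a
    preserves the divergence; for t = s_i no flow is left on the edge e_i, so
    the result is the flow of the tree in which f replaces e_i. *)
Lemma exchange_cost par' dep' ord' a b v :
  a != b -> [set a; b] \notin T -> separates par a b v ->
  rooted (([set a; b] |: T) :\ [set v; par v]) r par' dep' ord' ->
  let c u := side R par a b u * s u in
  wasserstein (adj_of (([set a; b] |: T) :\ [set v; par v])) mu nu =
  wasserstein (adj_of T) mu nu
    - \sum_(u | separates par a b u) `|c u|
    + (`|c v| + \sum_(u | separates par a b u) `|c u - c v|).
Proof.
set T' := _ :\ _; move=> ab abT sep_v rT' c; set t := c v.
pose sd := side R par a b.
pose h u := s u - t * sd u.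
have vr : v != r by apply: contraTneq sep_v => ->; apply: (separates_root rT).
have abv : [set a; b] != [set v; par v].
  by apply: contraNneq abT => ->; case/andP: (par_edge rT vr).
have hv0 : h v = 0.
  by rewrite /h /t /c -/sd mulrAC side_sqr // mul1r subrr.
pose x u w : R := ((u == a) && (w == b))%:R - ((u == b) && (w == a))%:R.
pose phi u w := up_flow r par h u w + t * x u w.
have x0 u w : [set u; w] != [set a; b] -> x u w = 0.
  rewrite /x => uw; rewrite (_ : (u == a) && _ = false); last first.
    by apply: contraNF uw => /andP[/eqP-> /eqP->].
  rewrite (_ : (u == b) && _ = false) ?subrr //.
  by apply: contraNF uw => /andP[/eqP-> /eqP->]; rewrite setUC.
have h_supp u w : ~~ adj_of T u w -> up_flow r par h u w = 0.
  exact: (up_flow_supp rT).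
have fl : is_flow T' (fun u => mu u - nu u) phi.
  split=> [u w|u w nuw|u].
  - by rewrite /phi up_flow_anti /x andbC [(u == b) && _]andbC; ring.
  - have uw_ab : [set u; w] != [set a; b].
      apply: contraNneq nuw => E; rewrite adjD1 E abv andbT /adj_of E setU11 andbT.
      by apply: contraNneq ab => Euw; case: (set2_inj E) => -[<- <-]; rewrite Euw.
    rewrite /phi (x0 _ _ uw_ab) mulr0 addr0.
    have [uw_v|uw_v] := eqVneq [set u; w] [set v; par v]; last first.
      apply: h_supp; apply: contraNN nuw => /(adj_sub (subsetUr [set [set a; b]] T)) uw.
      by rewrite adjD1 uw.
    have zero : up_flow r par h v (par v) = 0.
      apply/normr0_eq0; rewrite (up_flow_norm rT) hv0 normr0 if_same add0r.
      by case: ifP => // /andP[pr]; rewrite (negbTE (par_par rT vr pr)).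
    by case: (set2_inj uw_v) => -[-> ->]; rewrite // up_flow_anti zero oppr0.
  have E w : up_flow r par h u w = up_flow r par s u w -
     t * (up_flow r par (fun v => (anc par v a)%:R) u w
          - up_flow r par (fun v => (anc par v b)%:R) u w).
    rewrite /up_flow /h /sd /side.
    by do 2![case: ifP => _]; ring.
  rewrite /phi big_split /= -mulr_sumr.
  under eq_bigr do rewrite E.
  have div_side : \sum_w (up_flow r par (fun v => (anc par v a)%:R) u w
          - up_flow r par (fun v => (anc par v b)%:R) u w) = (u == a)%:R - (u == b)%:R :> R.
    by rewrite sumrB !(up_flow_anc_div R rT); ring.
  rewrite sumrB -mulr_sumr div_side.
  have tot0 : \sum_u (mu u - nu u) = 0 by rewrite sumrB tot subrr.
  have [_ _ ->] := sums_flow rT tot0.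
  have -> : \sum_w x u w = (u == a)%:R - (u == b)%:R.
    rewrite sumrB; congr (_ - _).
      by case: (u == a) => /=; [apply: (sum_indicator R b) | rewrite big1].
    by case: (u == b) => /=; [apply: (sum_indicator R a) | rewrite big1].
  by ring.
have cost : flow_cost phi = (\sum_(u | u != r) `|h u| + `|t|) *+ 2.
  rewrite mulrnDl -(up_flow_cost rT) /flow_cost.
  have -> : `|t| *+ 2 = \sum_u \sum_w `|t| * (((u == a) && (w == b))%:R + ((u == b) && (w == a))%:R).
    under eq_bigr do rewrite -mulr_sumr big_split /=.
    by rewrite -mulr_sumr big_split /= !sum_indicator2 mulr2n; ring.
  rewrite -big_split; apply: eq_bigr => u _; rewrite -big_split; apply: eq_bigr => w _ /=.
  rewrite /phi; have [uw|uw] := eqVneq [set u; w] [set a; b].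
    rewrite h_supp; last by rewrite /adj_of uw (negbTE abT) andbF.
    rewrite normr0 !add0r normrM /x; congr (_ * _).
    case: (set2_inj uw) => -[-> ->]; rewrite !eqxx (negbTE ab) ?[b == a]eq_sym ?(negbTE ab) /=.
      by rewrite subr0 addr0 normr1.
    by rewrite sub0r add0r normrN normr1.
  rewrite (x0 _ _ uw) mulr0 addr0.
  rewrite (_ : (u == a) && _ = false); last first.
    by apply: contraNF uw => /andP[/eqP-> /eqP->].
  rewrite (_ : (u == b) && _ = false) ?addr0 ?mulr0 ?addr0 //.
  by apply: contraNF uw => /andP[/eqP-> /eqP->]; rewrite setUC.
have := tree_wasserstein_flow rT' mu0 nu0 tot fl; rewrite cost.
rewrite (tree_wasserstein rT mu0 nu0 tot) -/s.
have sep_r u : separates par a b u -> u != r.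
  by apply: contraTneq => ->; apply: (separates_root rT).
have split_sep (F : V -> R) : \sum_(u | u != r) F u =
    \sum_(u | separates par a b u) F u + \sum_(u | (u != r) && ~~ separates par a b u) F u.
  rewrite (bigID (separates par a b)) /=; congr (_ + _); apply: eq_bigl => u.
  by case: (boolP (separates _ _ _ _)) => [/sep_r ->|]; rewrite ?andbF.
rewrite (split_sep (fun u => `|h u|)) (split_sep (fun u => `|s u|)).
have -> : \sum_(u | (u != r) && ~~ separates par a b u) `|h u| =
          \sum_(u | (u != r) && ~~ separates par a b u) `|s u|.
  by apply: eq_bigr => u /andP[_ /side_eq0 E]; rewrite /h /sd E mulr0 subr0.
have -> : \sum_(u | separates par a b u) `|h u| = \sum_(u | separates par a b u) `|c u - c v|.
  apply: eq_bigr => u sep_u; rewrite -[LHS]mul1r -(side_norm sep_u) -normrM.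
  by rewrite /h /c mulrBr -/sd -/t mulrCA side_sqr // mulr1.
have -> : \sum_(u | separates par a b u) `|s u| = \sum_(u | separates par a b u) `|c u|.
  by apply: eq_bigr => u sep_u; rewrite /c normrM side_norm // mul1r.
by rewrite -/t; lra.
Qed.

End ExchangeCost.

(** * Rooting a tree by depth first search *)

Section RootTree.
Variables (V : finType) (e : rel V) (es : seq (V * V)).
Hypotheses (e_irr : irreflexive e) (es_e : edge_list e es).
Implicit Types (T : {set {set V}}) (u v w : V) (nb : V -> seq V).

Lemma edge_list_adj p : p \in es -> [set p.1; p.2] \in edges e.
Proof. by move=> p_es; rewrite -(es_e.2); apply: map_f. Qed.

Lemma edge_list_neq p : p \in es -> p.1 != p.2.
Proof.
move/edge_list_adj/edgesP => [a [b [E ab]]].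
have nab : a != b by apply: contraTneq ab => ->; rewrite e_irr.
by case: (set2_inj E) => -[-> ->]; rewrite // eq_sym.
Qed.

Lemma edge_list_count (f : {set V}) :
  count (fun p => [set p.1; p.2] == f) es = (f \in edges e).
Proof.
have [E_uniq E_e] := es_e; rewrite -E_e -(count_uniq_mem _ E_uniq) count_map.
by apply: eq_count.
Qed.

Lemma tree_neighbors_time T l nb : (tree_neighbors T l nb).2 = (size l).+1.
Proof. by elim: l nb => //= -[u v] l IH nb; rewrite IH. Qed.

Lemma tree_neighbors_size T l nb v :
  (size ((tree_neighbors T l nb).1 v) <= size (nb v) + 2 * size l)%N.
Proof.
elim: l nb => [|[u w] l IH] nb /=; first by rewrite addn0.
apply: leq_trans (IH _) _; case: ifP => _ /=; last lia.
by rewrite /upd; do ![case: eqP => [<-|_] /=]; lia.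
Qed.

Lemma tree_neighbors_count T l nb v w :
  {in l, forall p, p.1 != p.2} ->
  count_mem w ((tree_neighbors T l nb).1 v) =
  (count_mem w (nb v) +
   count (fun p => ([set p.1; p.2] == [set v; w]) && ([set p.1; p.2] \in T)) l)%N.
Proof.
elim: l nb => [|[a b] l IH] nb l_neq /=; first by rewrite addn0.
rewrite IH; last by move=> p p_l; apply: l_neq; rewrite inE p_l orbT.
have /= ab := l_neq (a, b) (mem_head _ _).
rewrite addnA; congr (_ + _)%N; case: ifP => abT; last by rewrite andbF addn0.
rewrite andbT /upd; have [E|nE] := eqVneq [set a; b] [set v; w].
  by case: (set2_inj E) => -[<- <-]; rewrite !eqxx ?(negbTE ab) /= ?eqxx ?[b == a]eq_sym ?(negbTE ab) /= ?eqxx addnC.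
case: (eqVneq v b) nE => [->|vb] nE.
  rewrite eq_sym (negbTE ab) /=.
  by case: (eqVneq a w) nE => [->|_ _]; rewrite ?[[set b; w]]setUC ?eqxx // add0n addn0.
case: (eqVneq v a) nE => [->|va] nE; last by rewrite addn0.
by rewrite /=; case: (eqVneq b w) nE => [->|_ _]; rewrite ?eqxx // addn0.
Qed.

(** Counting occurrences gives both the members of an adjacency list and the
    absence of repetitions, without which a vertex would be pushed twice. *)
Lemma tree_neighborsE T v w : T \subset edges e ->
  count_mem w ((tree_neighbors T es (fun=> [::])).1 v) = adj_of T v w.
Proof.
move=> sT; rewrite tree_neighbors_count; last exact: edge_list_neq.
rewrite add0n /adj_of; case: (boolP ([set v; w] \in T)) => vwT; last first.
  rewrite andbF; apply/eqP; rewrite -leqn0 leqNgt -has_count.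
  by apply/hasPn => p _ /=; case: eqP => //= ->.
have vwE := subsetP sT _ vwT.
rewrite andbT (eq_count (a2 := fun p => [set p.1; p.2] == [set v; w])); last first.
  by move=> p /=; case: eqP => // ->.
rewrite edge_list_count vwE; have [a [b [E ab]]] := edgesP _ _ vwE.
have nab : a != b by apply: contraTneq ab => ->; rewrite e_irr.
by case: (set2_inj E) => -[-> ->]; rewrite ?nab // eq_sym nab.
Qed.

Lemma push_children_time v ws st par (dep : V -> nat) :
  (push_children v ws st par dep).2 = (size ws).+1.
Proof. by elim: ws st par dep => //= w ws IH st par dep; case: ifP => _; rewrite IH. Qed.

Lemma push_children_val v ws st par (dep : V -> nat) : v \notin ws ->
  exists par1 dep1, let ws' := [seq w <- ws | w != par v] in
  [/\ (push_children v ws st par dep).1 = (rev ws' ++ st, par1, dep1),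
   forall u, par1 u = if u \in ws' then v else par u &
   forall u, dep1 u = if u \in ws' then (dep v).+1 else dep u].
Proof.
elim: ws st par dep => [|w ws IH] st par dep /=; first by exists par, dep.
rewrite inE negb_or => /andP[vw v_ws].
case: eqVneq => [_|wp] /=; first exact: IH.
have [par1 [dep1 /= [E Ep Ed]]] := IH (w :: st) (upd par w v) (upd dep w (dep v).+1) v_ws.
move: E Ep Ed; rewrite /upd (negbTE vw) => E Ep Ed.
exists par1, dep1; split; first by rewrite E rev_cons cat_rcons.
  by move=> u; rewrite Ep inE; case: (u == w) => //=; case: ifP.
by move=> u; rewrite Ed inE; case: (u == w) => //=; case: ifP.
Qed.

Lemma leaves_first_eq (par par1 : V -> V) r ord : {in ord, par =1 par1} ->
  leaves_first par r ord -> leaves_first par1 r ord.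
Proof.
elim: ord => //= v ord IH E /and3P[-> pv lf]; rewrite -E ?mem_head // pv /=.
by apply: IH lf => u u_o; apply: E; rewrite inE u_o orbT.
Qed.

(** The state of the search: every vertex found so far hangs on a visited
    parent, and the neighbours of the visited ones have all been found.  The
    second alternative of [inv_root] is the initial state. *)
Record dfs_inv T r (st : seq V) (par : V -> V) (dep : V -> nat) (ord : seq V) : Prop := DfsInv {
  inv_uniq : uniq (st ++ ord);
  inv_par_root : par r = r;
  inv_dep_root : dep r = 0%N;
  inv_found : forall v, v \in st ++ ord -> v != r ->
    [/\ adj_of T v (par v), par v \in ord & dep v = (dep (par v)).+1];
  inv_explored : forall v w, v \in ord -> adj_of T v w -> w \in st ++ ord;
  inv_leaves_first : leaves_first par r ord;
  inv_root : r \in ord \/ (st = [:: r] /\ ord = [::]) }.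

Lemma dfs_inv_connect T r st par dep ord g u :
  dfs_inv T r st par dep ord ->
  (forall v, v \in st ++ ord -> v != r -> [set v; par v] != g) ->
  u \in st ++ ord -> connect (adj_of (T :\ g)) u r.
Proof.
move=> inv ng; have [n] := ubnP (dep u); elim: n u => // n IH u du u_o.
have [->|ur] := eqVneq u r; first exact: connect0.
have [upar p_o d_u] := inv_found inv u_o ur.
apply: (@connect_trans _ _ (par u)).
  by apply: connect1; rewrite adjD1 upar ng.
by apply: IH; [rewrite d_u in du | rewrite mem_cat p_o orbT].
Qed.

(** A neighbour of v other than its parent cannot have been found before v is
    explored: it would close a cycle through the root. *)
Lemma dfs_fresh T r v st par dep ord w : all_bridges T ->
  dfs_inv T r (v :: st) par dep ord -> adj_of T v w -> w != par v ->
  w \notin (v :: st) ++ ord.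
Proof.
move=> bri inv vw wp; apply/negP => w_found.
have v_found : v \in (v :: st) ++ ord by rewrite mem_head.
case/negP: (bri _ _ vw).
have v_ord : v \notin ord.
  have /= /andP[+ _] := inv_uniq inv; apply: contra => v_o.
  by rewrite mem_cat v_o orbT.
have ng u : u \in (v :: st) ++ ord -> u != r -> [set u; par u] != [set v; w].
  move=> u_found ur; have [_ p_ord _] := inv_found inv u_found ur.
  apply/eqP => /set2_inj[[Eu Ep]|[Eu Ep]].
    by move: wp; rewrite -Ep Eu eqxx.
  by rewrite -Ep p_ord in v_ord.
apply: connect_trans (dfs_inv_connect inv ng v_found) _.
by rewrite connect_adj_sym; apply: dfs_inv_connect inv ng w_found.
Qed.

Lemma dfs_step T r v st par dep ord nbv : all_bridges T ->
  dfs_inv T r (v :: st) par dep ord ->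
  uniq nbv -> (forall w, (w \in nbv) = adj_of T v w) ->
  exists st1 par1 dep1,
    (push_children v nbv st par dep).1 = (st1, par1, dep1) /\
    dfs_inv T r st1 par1 dep1 (v :: ord).
Proof.
move=> bri inv nb_uniq nbE.
have v_nb : v \notin nbv by rewrite nbE adj_irr.
have [par1 [dep1 /= []]] := push_children_val st par dep v_nb.
set ws := [seq w <- nbv | w != par v] => E Ep Ed.
exists (rev ws ++ st), par1, dep1; split=> //.
have v_found : v \in (v :: st) ++ ord by rewrite mem_head.
have fresh w : w \in ws -> w \notin (v :: st) ++ ord.
  by rewrite mem_filter nbE => /andP[wp vw]; apply: dfs_fresh inv vw wp.
have old_par u : u \in (v :: st) ++ ord -> par1 u = par u.
  by move=> u_old; rewrite Ep ifN //; apply: contraL u_old => /fresh.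
have old_dep u : u \in (v :: st) ++ ord -> dep1 u = dep u.
  by move=> u_old; rewrite Ed ifN //; apply: contraL u_old => /fresh.
have ord_old u : u \in ord -> u \in (v :: st) ++ ord.
  by move=> u_o; rewrite mem_cat u_o orbT.
have r_old : r \in (v :: st) ++ ord.
  by case: (inv_root inv) => [/ord_old//|[-> ->]]; rewrite mem_head.
have memE u : (u \in (rev ws ++ st) ++ v :: ord) = (u \in ws) || (u \in (v :: st) ++ ord).
  by rewrite !mem_cat !inE mem_rev -!orbA; do !bool_congr.
have v_ord : v \notin ord.
  have /= /andP[+ _] := inv_uniq inv; apply: contra => v_o.
  by rewrite mem_cat v_o orbT.
split.
- have /perm_uniq -> : perm_eq ((rev ws ++ st) ++ v :: ord) (ws ++ ((v :: st) ++ ord)).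
    rewrite -catA; apply: perm_cat; first by rewrite perm_rev.
    by rewrite (perm_catCA st [:: v] ord).
  rewrite cat_uniq (filter_uniq _ nb_uniq) (inv_uniq inv) andbT andTb.
  by apply/hasPn => u u_old; apply: contraL u_old => /fresh.
- by rewrite old_par // (inv_par_root inv).
- by rewrite old_dep // (inv_dep_root inv).
- move=> u; rewrite memE => /orP[u_ws|u_old] ur.
    rewrite Ep Ed u_ws mem_head (old_dep _ v_found); split=> //.
    by move: u_ws; rewrite mem_filter nbE adj_sym => /andP[].
  have [u_par p_o d_u] := inv_found inv u_old ur.
  rewrite (old_par _ u_old) (old_dep _ u_old) inE p_o orbT; split=> //.
  by rewrite old_dep // ord_old.
- move=> u w; rewrite inE memE => /predU1P[->|u_o] uw; last first.
    by rewrite (inv_explored inv u_o uw) orbT.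
  rewrite mem_filter nbE uw andbT; case: eqVneq => //= Ew.
  have [vr|vr] := eqVneq v r.
    by move: uw; rewrite Ew vr (inv_par_root inv) adj_irr.
  by have [_ /ord_old] := inv_found inv v_found vr; rewrite Ew.
- rewrite /= v_ord (leaves_first_eq _ (inv_leaves_first inv)) ?andbT; last first.
    by move=> u /ord_old /old_par.
  have [vr|vr] := eqVneq v r; last first.
    by rewrite old_par //; have [] := inv_found inv v_found vr.
  by case: (inv_root inv) v_ord => [|[_ ->//]]; rewrite vr => ->.
left; rewrite inE; case: (inv_root inv) => [->|[[->] _]]; last by rewrite eqxx.
by rewrite orbT.
Qed.

Lemma dfs_spec T r nb fuel st par dep ord : all_bridges T ->
  (forall v, uniq (nb v)) -> (forall v w, (w \in nb v) = adj_of T v w) ->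
  dfs_inv T r st par dep ord -> (fuel + size ord = #|V|)%N ->
  exists par1 dep1 ord1, (Defs.dfs fuel nb st par dep ord).1 = (par1, dep1, ord1) /\
    dfs_inv T r [::] par1 dep1 ord1.
Proof.
move=> bri nb_uniq nbE.
elim: fuel st par dep ord => [|fuel IH] st par dep ord inv sz.
  exists par, dep, ord; split=> //.
  case: st inv => [//|v st] inv; have := max_card (mem ((v :: st) ++ ord)).
  by rewrite (card_uniqP (inv_uniq inv)) size_cat /= -sz add0n addSn ltnNge leq_addl.
case: st inv => [|v st] inv; first by exists par, dep, ord.
have [st1 [par1 [dep1 [E inv1]]]] := dfs_step bri inv (nb_uniq v) (nbE v).
have [|par2 [dep2 [ord2 [E2 inv2]]]] := IH st1 par1 dep1 (v :: ord) inv1.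
  by rewrite /= addnS.
by exists par2, dep2, ord2; rewrite /= E.
Qed.

(** Bounding every adjacency list by m is crude, but its cost |E| |V| is no more
    than that of the search for exchanges. *)
Lemma dfs_time nb (m : nat) fuel st par dep ord : (forall v, size (nb v) <= m)%N ->
  ((Defs.dfs fuel nb st par dep ord).2 <= fuel * (m + 2) + 1)%N.
Proof.
move=> nbm; elim: fuel st par dep ord => [|fuel IH] [|v st] par dep ord //=.
  by rewrite addn1.
have := push_children_time v (nb v) st par dep.
case: (push_children _ _ _ _ _) => [[[st1 par1] dep1] t] /= ->.
have := IH st1 par1 dep1 (v :: ord); have := nbm v; lia.
Qed.

(** Once the stack is empty the visited set is closed under adjacency, so it is
    everything; and a tree edge not of the form {v, par v} would have its ends
    joined through the root by the edges of that form, hence not be a bridge. *)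
Lemma root_tree_spec T r : spanning_tree e T ->
  exists par dep ord, (root_tree es T r).1 = (par, dep, ord) /\ rooted T r par dep ord.
Proof.
move=> /spanning_treeP[sub con bri]; rewrite /root_tree /=.
set nb := (tree_neighbors _ _ _).1.
have nbE v w : (w \in nb v) = adj_of T v w.
  by rewrite -has_pred1 has_count tree_neighborsE //; case: (adj_of _ _ _).
have nb_uniq v : uniq (nb v).
  apply: count_mem_uniq => w; rewrite nbE; exact: tree_neighborsE.
have [||par [dep [ord [E inv]]]] := @dfs_spec T r nb #|V| [:: r] id (fun=> 0%N) [::] bri nb_uniq nbE.
- split=> //; last by right.
  by move=> v; rewrite cats0 inE => /eqP ->; rewrite eqxx.
- by rewrite addn0.
exists par, dep, ord; split=> //.
have r_o : r \in ord by case: (inv_root inv) => // -[].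
have ord_all v : v \in ord.
  have : closed (adj_of T) (mem ord).
    apply: intro_closed; first exact: connect_adj_sym.
    by move=> u w uw u_o; apply: (inv_explored inv u_o uw).
  by move/closed_connect => /(_ r v (con r v)) <-.
split=> //.
- exact: inv_par_root inv.
- exact: inv_dep_root inv.
- by move=> v vr; have [] := inv_found inv (ord_all v) vr.
- by move=> v vr; have [] := inv_found inv (ord_all v) vr.
- move=> u w uw.
  have [/existsP[v /andP[vr /eqP /set2_inj[[<- <-]|[<- <-]]]]|] :=
    boolP [exists v, (v != r) && ([set v; par v] == [set u; w])]; auto.
  rewrite negb_exists => /forallP nv; case/negP: (bri _ _ uw).
  have ng v : v \in [::] ++ ord -> v != r -> [set v; par v] != [set u; w].
    by move=> _ vr; have := nv v; rewrite vr.
  apply: connect_trans (dfs_inv_connect inv ng (ord_all u)) _.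
  by rewrite connect_adj_sym; apply: dfs_inv_connect inv ng (ord_all w).
exact: inv_leaves_first inv.
Qed.

Lemma root_tree_time T r :
  ((root_tree es T r).2 <= 3 * #|V| + size es + 2 + #|V| * (2 * size es + 2))%N.
Proof.
rewrite /root_tree /= tree_neighbors_time.
set nb := (tree_neighbors _ _ _).1.
have := @dfs_time nb (2 * size es) #|V| [:: r] id (fun=> 0%N) [::].
have nb_size v : (size (nb v) <= 2 * size es)%N by apply: tree_neighbors_size.
move=> /(_ nb_size).
have arith N M t : (t <= N * (2 * M + 2) + 1)%N ->
  (N + (M.+1 + (N + (N + t))) <= 3 * N + M + 2 + N * (2 * M + 2))%N by lia.
exact: arith.
Qed.

End RootTree.

(** * Medians and the exchange search *)

Section Deviation.
Variables (R : realType) (A : Type).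
Implicit Types (l : seq (R * A)) (t : R).

Lemma deviation_val t l : (deviation t l).1 = \sum_(p <- l) `|p.1 - t|.
Proof. by elim: l => [|p l IH]; rewrite ?big_nil // big_cons -IH. Qed.

Lemma deviation_time t l : (deviation t l).2 = (size l).+1.
Proof. by elim: l => //= p l ->; rewrite addn0. Qed.

(** Moving t away from m by an amount c raises each term on the near side by c
    and lowers each of the others by at most c. *)
Lemma median_min l m t :
  (2 * count (fun p => p.1 < m)%R l <= size l)%N ->
  (size l <= 2 * count (fun p => p.1 <= m)%R l)%N ->
  \sum_(p <- l) `|p.1 - m| <= \sum_(p <- l) `|p.1 - t|.
Proof.
move=> lo hi.
pose nle := count (fun p : R * A => p.1 <= m) l.
pose nlt := count (fun p : R * A => p.1 < m) l.
have E_le (k c n d : R) : (2 * (k + c) - (n + 1)) * d = (2 * c - n) * d + (2 * k - 1) * d.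
  by ring.
have E_lt (k c n d : R) : (n + 1 - 2 * (k + c)) * d = (n - 2 * c) * d + (1 - 2 * k) * d.
  by ring.
have right : (2 * nle%:R - (size l)%:R) * (t - m) <=
    \sum_(p <- l) `|p.1 - t| - \sum_(p <- l) `|p.1 - m| \/ t < m.
  case: (ltP t m) => tm; [by right|left].
  rewrite /nle; elim: {lo hi nle nlt} l => [|p l].
    by rewrite !big_nil mulr0 !subrr mul0r.
  rewrite !big_cons /= natrD -[(size l).+1%:R]natr1 E_le => IH.
  have tri : `|p.1 - m| <= `|p.1 - t| + (t - m).
    by have := ler_normD (p.1 - t) (t - m); rewrite (ger0_norm (x := t - m)) ?subr_ge0 // addrA subrK.
  suff step : (2 * (p.1 <= m)%R%:R - 1) * (t - m) <= `|p.1 - t| - `|p.1 - m|.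
    by apply: le_trans (lerD IH step) _; lra.
  case: (leP p.1 m) => pm /=; last by lra.
  rewrite (ler0_norm (x := p.1 - m)) ?subr_le0 //.
  rewrite (ler0_norm (x := p.1 - t)) ?subr_le0 ?(le_trans pm) //; lra.
have left : ((size l)%:R - 2 * nlt%:R) * (m - t) <=
    \sum_(p <- l) `|p.1 - t| - \sum_(p <- l) `|p.1 - m| \/ m < t.
  case: (ltP m t) => tm; [by right|left].
  rewrite /nlt; elim: {lo hi right nle nlt} l => [|p l].
    by rewrite !big_nil mulr0 !subrr mul0r.
  rewrite !big_cons /= natrD -[(size l).+1%:R]natr1 E_lt => IH.
  have tri : `|p.1 - m| <= `|p.1 - t| + (m - t).
    have := ler_normD (p.1 - t) (t - m).
    by rewrite (ler0_norm (x := t - m)) ?subr_le0 // opprB addrA subrK.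
  suff step : (1 - 2 * (p.1 < m)%R%:R) * (m - t) <= `|p.1 - t| - `|p.1 - m|.
    by apply: le_trans (lerD IH step) _; lra.
  case: (ltP p.1 m) => pm /=; first by lra.
  rewrite (ger0_norm (x := p.1 - m)) ?subr_ge0 //.
  rewrite (ger0_norm (x := p.1 - t)) ?subr_ge0 ?(le_trans tm) //; lra.
have hi' : (size l)%:R <= 2 * nle%:R :> R by rewrite -natrM ler_nat.
have lo' : 2 * nlt%:R <= (size l)%:R :> R by rewrite -natrM ler_nat.
case: (lerP m t) => tm.
  case: right => [right|]; last by rewrite ltNge tm.
  have := @mulr_ge0 R _ (t - m) (_ : 0 <= 2 * nle%:R - (size l)%:R).
  by rewrite !subr_ge0 => /(_ hi' tm); lra.
case: left => [left|]; last by rewrite ltNge ltW.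
have := @mulr_ge0 R _ (m - t) (_ : 0 <= (size l)%:R - 2 * nlt%:R).
by rewrite !subr_ge0 => /(_ lo' (ltW tm)); lra.
Qed.

End Deviation.

Section TreePath.
Variables (R : realType) (V : finType) (T : {set {set V}}) (r : V).
Variables (par : V -> V) (dep : V -> nat) (ord : seq V).
Hypothesis rT : rooted T r par dep ord.
Variable s : V -> R.
Notation separates := (separates par).
Notation side := (side R par).

Lemma dep_root_min u v : (dep u <= dep v)%N -> u != v -> v != r.
Proof.
move=> duv; apply: contraNneq => vr; rewrite vr (dep_root rT) leqn0 in duv.
by rewrite vr (dep_eq0 rT (eqP duv)).
Qed.

Lemma anc_deeper u v : (dep u <= dep v)%N -> u != v -> ~~ anc par v u.
Proof.
move=> duv uv; rewrite anc_step (negbTE uv) /=.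
have [->|ur] := eqVneq u r.
  by rewrite (par_root rT) (anc_root_only rT) // (dep_root_min duv uv).
by apply/negP => /(anc_dep rT); rewrite leqNgt (leq_trans (dep_lt rT ur)).
Qed.

Lemma side_sym a b v : side b a v = - side a b v.
Proof. by rewrite /side opprB. Qed.

Lemma separates_sym a b v : separates b a v = separates a b v.
Proof. by rewrite /separates eq_sym. Qed.

Lemma anc_par_neq a v : v != a -> anc par v (par a) = anc par v a.
Proof. by move=> va; rewrite (anc_step _ v a) eq_sym (negbTE va). Qed.

(** Climbing one step from the deeper end a removes exactly the edge above a
    from the separating ones. *)
Lemma separates_step a b : (dep b <= dep a)%N -> b != a ->
  [/\ side a b a = 1, separates a b a, ~~ separates (par a) b a &
      forall v, v != a -> separates (par a) b v = separates a b v /\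
                          side (par a) b v = side a b v].
Proof.
move=> dba ba; have nab := anc_deeper dba ba; have ar := dep_root_min dba ba.
rewrite /separates /side (anc_refl _ a) (negbTE nab) (negbTE (anc_par rT ar)) subr0.
by split=> // v va; rewrite anc_par_neq.
Qed.

(** The steps of the climb are counted by the separating edges, so any fuel not
    below their number is enough. *)
Lemma tree_path_perm fuel a b acc : (#|separates a b| <= fuel)%N ->
  perm_eq (tree_path fuel par dep s a b acc).1
    ([seq (side a b v * s v, Some v) | v <- enum (separates a b)] ++ acc).
Proof.
elim: fuel a b acc => [|fuel IH] a b acc /= szf.
  rewrite (_ : enum _ = [::]) //; apply/eqP.
  by rewrite -size_eq0 -cardE -leqn0.
case: (eqVneq a b) szf => [->|ab] szf.
  rewrite (_ : enum _ = [::]) //; apply/eqP; rewrite -size_eq0 -cardE.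
  by apply/eqP/eq_card0 => v; rewrite unfold_in /separates eqxx.
case: leqP => dba.
  have [|sa sepa nsepa other] := separates_step dba; first by rewrite eq_sym.
  have enumE : perm_eq (enum (separates a b)) (a :: enum (separates (par a) b)).
    apply: uniq_perm; rewrite /= ?enum_uniq ?mem_enum ?nsepa // => v.
    rewrite inE !mem_enum !unfold_in -!/(separates _ _ _); case: (eqVneq v a) => [->|va] //=.
    by rewrite (other _ va).1.
  apply: perm_trans (IH _ _ _ _) _.
    by rewrite -ltnS (leq_trans _ szf) // !cardE (perm_size enumE).
  have := perm_cat (perm_map (fun v => (side a b v * s v, Some v)) enumE) (perm_refl acc).
  rewrite perm_sym => /(perm_trans _); apply.
  rewrite /= sa mul1r perm_catC /= perm_cons perm_catC perm_cat2r.
  have /eq_in_map -> // : {in enum (separates (par a) b),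
      (fun v => (side (par a) b v * s v, Some v)) =1 (fun v => (side a b v * s v, Some v))}.
  move=> v; rewrite mem_enum unfold_in -/(separates _ _ _) => sv.
  by rewrite (other v _).2 //; apply: contraTneq sv => ->.
have [sb sepb nsepb other] := separates_step (ltnW dba) ab.
have enumE : perm_eq (enum (separates a b)) (b :: enum (separates a (par b))).
  apply: uniq_perm; rewrite /= ?enum_uniq ?mem_enum.
  - by [].
  - by rewrite unfold_in -/(separates _ _ _) separates_sym nsepb.
  move=> v; rewrite inE !mem_enum !unfold_in -!/(separates _ _ _); case: (eqVneq v b) => [->|vb] //=.
    by rewrite separates_sym.
  by rewrite -(separates_sym a b) -(separates_sym a (par b)) (other _ vb).1.
apply: perm_trans (IH _ _ _ _) _.
  by rewrite -ltnS (leq_trans _ szf) // !cardE (perm_size enumE).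
have := perm_cat (perm_map (fun v => (side a b v * s v, Some v)) enumE) (perm_refl acc).
rewrite perm_sym => /(perm_trans _); apply.
rewrite /= side_sym sb mulN1r perm_catC /= perm_cons perm_catC perm_cat2r.
have /eq_in_map -> // : {in enum (separates a (par b)),
    (fun v => (side a (par b) v * s v, Some v)) =1 (fun v => (side a b v * s v, Some v))}.
move=> v; rewrite mem_enum unfold_in -/(separates _ _ _) => sv.
rewrite [side a _ _]side_sym [in RHS]side_sym (other v _).2 //.
by apply: contraTneq sv => ->; rewrite separates_sym.
Qed.

Lemma tree_path_time fuel a b acc :
  ((tree_path fuel par dep s a b acc).2 <= fuel.+1)%N.
Proof.
elim: fuel a b acc => //= fuel IH a b acc.
by case: eqP => //= _; case: ifP => _; apply: IH.
Qed.

Lemma separates_card a b : (#|separates a b| < #|V|)%N.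
Proof.
rewrite -(cardC (separates a b)) -[X in (X < _)%N]addn0 ltn_add2l.
by apply/card_gt0P; exists r; rewrite inE unfold_in (separates_root rT).
Qed.

(** By [exchange_cost], the decrease of the cost when {a, b} replaces the edge
    {v, par v}. *)
Definition exchange_gain a b v : R :=
  \sum_(u | separates a b u) `|side a b u * s u| -
  (`|side a b v * s v| +
   \sum_(u | separates a b u) `|side a b u * s u - side a b v * s v|).

Notation rank_le := (fun p q : R * option V => p.1 <= q.1).

Lemma best_exchangeE a b :
  let path := tree_path #|V| par dep s a b [::] in
  let l0 := (0, None) :: path.1 in
  let m := select rank_le (0, None) (size l0).+1 l0 (size l0)./2 in
  best_exchange par dep s a b =
    ((\sum_(p <- l0) `|p.1 - 0| - \sum_(p <- l0) `|p.1 - m.1.1|, m.1.2),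
     (path.2 + ((size l0).+1 + (m.2 + ((size l0).+1 + ((size l0).+1 + 0)))))%N).
Proof.
move=> path l0 m; rewrite /best_exchange /bind -/path -/l0 len_val -/m.
by rewrite /ret !deviation_val !deviation_time len_time.
Qed.

(** Exchanging {v, par v} costs the sum of the deviations from its value, the
    entry s_0 = 0 accounting for {a, b} itself; the median minimizes this sum
    and is an entry of the list, hence names an edge to delete unless it is s_0,
    in which case no exchange for {a, b} lowers the cost. *)
Lemma best_exchange_spec a b :
  let res := (best_exchange par dep s a b).1 in
  [/\ forall v, separates a b v -> exchange_gain a b v <= res.1 &
      if res.2 is Some v then separates a b v /\ res.1 = exchange_gain a b v
      else res.1 = 0].
Proof.
rewrite best_exchangeE; set l := (tree_path _ _ _ _ _ _ _).1.
have l_perm : perm_eq l [seq (side a b v * s v, Some v) | v <- enum (separates a b)].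
  by rewrite -[X in perm_eq _ X]cats0; apply/tree_path_perm/ltnW/separates_card.
set le := fun p q : R * option V => p.1 <= q.1.
have le_total : total le by move=> p q; apply: le_total.
have le_trans : transitive le by move=> p q t; apply: le_trans.
set l0 := (0, None) :: l.
have dev t : \sum_(p <- l0) `|p.1 - t| =
    `|t| + \sum_(u | separates a b u) `|side a b u * s u - t|.
  by rewrite big_cons sub0r normrN (perm_big _ l_perm) big_map big_enum.
have [|] := @select_spec _ le le_total le_trans (0, None) (size l0).+1 l0 (size l0)./2 (leqnn _).
  by rewrite -divn2 ltn_Pdiv.
set m := (select _ _ _ _ _).1 => -[m_l0 lo hi] _.
rewrite /= !dev normr0 add0r.
have dev0 : \sum_(u | separates a b u) `|side a b u * s u - 0| =
    \sum_(u | separates a b u) `|side a b u * s u|.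
  by apply: eq_bigr => u _; rewrite subr0.
have gain_m v : m.1 = side a b v * s v -> exchange_gain a b v =
   \sum_(u | separates a b u) `|side a b u * s u - 0| -
   (`|m.1| + \sum_(u | separates a b u) `|side a b u * s u - m.1|).
  by rewrite dev0 => ->.
split=> [v sep_v|].
  rewrite /exchange_gain -dev0 lerD2l lerN2 -!dev; apply: median_min.
    rewrite (eq_count (a2 := fun p => ~~ le m p)); last by move=> p; rewrite /le ltNge.
    apply: leq_trans (leq_mul (leqnn 2) lo) _.
    by rewrite -[X in (_ <= X)%N]odd_double_half mul2n leq_addl.
  apply: leq_trans _ (leq_mul (leqnn 2) hi).
  rewrite -[X in (X <= _)%N]odd_double_half mul2n doubleS -addn2 addnC leq_add2l.
  by case: (odd _).
move: m_l0 gain_m; rewrite inE (perm_mem l_perm).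
case/predU1P => [-> _|/mapP[v]] /=.
  by rewrite dev0 normr0 add0r subrr.
rewrite mem_enum unfold_in => sep_v -> gain_m.
by split=> //; rewrite (gain_m v).
Qed.

Lemma best_exchange_time a b :
  ((best_exchange par dep s a b).2 <= 204 * #|V| + 24)%N.
Proof.
rewrite best_exchangeE; have := tree_path_time #|V| a b [::].
set l := (tree_path _ _ _ _ _ _ _).1 => path_t.
have l_perm : perm_eq l [seq (side a b v * s v, Some v) | v <- enum (separates a b)].
  by rewrite -[X in perm_eq _ X]cats0; apply/tree_path_perm/ltnW/separates_card.
have size_l : (size l < #|V|)%N.
  by rewrite (perm_size l_perm) size_map -cardE separates_card.
set le := fun p q : R * option V => p.1 <= q.1.
have le_total : total le by move=> p q; apply: le_total.
have le_trans : transitive le by move=> p q t; apply: le_trans.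
set l0 := (0, None) :: l.
have [|_] := @select_spec _ le le_total le_trans (0, None) (size l0).+1 l0 (size l0)./2 (leqnn _).
  by rewrite -divn2 ltn_Pdiv.
move=> sel_t.
have arith n p t N : (p <= N.+1)%N -> (n < N)%N -> (t <= 200 * n.+1 + 20)%N ->
  (p + (n.+2 + (t + (n.+2 + (n.+2 + 0)))) <= 204 * N + 24)%N by lia.
exact: arith path_t size_l sel_t.
Qed.

Variable es : seq (V * V).

(** The invariant of the search: a recorded decrease is positive and achieved by
    the recorded exchange. *)
Definition recorded (best : R * option ({set V} * {set V})) : Prop :=
  if best.2 is Some (f, g) then
    0 < best.1 /\ exists p v,
      [/\ p \in es, [set p.1; p.2] \notin T, separates p.1 p.2 v,
          (f, g) = ([set p.1; p.2], [set v; par v]) &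
          best.1 = exchange_gain p.1 p.2 v]
  else best.1 = 0.

Lemma search_spec l best : {subset l <= es} -> recorded best ->
  let res := (search T par dep s l best).1 in
  [/\ recorded res, best.1 <= res.1 &
      forall p v, p \in l -> [set p.1; p.2] \notin T -> separates p.1 p.2 v ->
        exchange_gain p.1 p.2 v <= res.1].
Proof.
elim: l best => [|[a b] l IH] best sub ok /=; first by split.
have sub' : {subset l <= es} by move=> p p_l; apply: sub; rewrite inE p_l orbT.
case: ifP => [abT|/negbT abT].
  have [ok' le_res best_res] := IH best sub' ok.
  split=> // p v; rewrite inE => /predU1P[->|p_l]; first by rewrite abT.
  exact: best_res.
have [] := best_exchange_spec a b.
case: (best_exchange par dep s a b) => [[gain del] t] /= gain_max gain_del.
set best' := if del is Some v then _ else _.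
have ok_best' : [/\ recorded best', best.1 <= best'.1 & gain <= best'.1].
  rewrite /best'; case: del gain_del {best'} => [v [sep_v gainE]|->].
    case: ltP => [lt_gain|le_gain]; split=> //=; last exact: ltW.
    split; last by exists (a, b), v; split=> //; apply: sub; rewrite mem_head.
    apply: le_lt_trans lt_gain.
    by move: ok; rewrite /recorded; case: best.2 => [[f g] [/ltW]|->].
  split=> //; move: ok; rewrite /recorded.
  by case: best.2 => [[f g] [/ltW]|->].
case: ok_best' => ok' le' gain'.
have [ok2 le_res best_res] := IH best' sub' ok'.
split=> //; first exact: le_trans le_res.
move=> p v; rewrite inE => /predU1P[->/= _ sep_v|p_l]; last exact: best_res.
by apply: le_trans (gain_max _ sep_v) _; apply: le_trans le_res.
Qed.

Lemma search_cons a b l best : search T par dep s ((a, b) :: l) best =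
  tick (if [set a; b] \in T then search T par dep s l best
        else let! (gain, del) := best_exchange par dep s a b in
             search T par dep s l
               (if del is Some v then
                  if best.1 < gain
                  then (gain, Some ([set a; b], [set v; par v])) else best
                else best)).
Proof. by []. Qed.

Lemma search_time l best :
  ((search T par dep s l best).2 <= size l * (204 * #|V| + 25) + 1)%N.
Proof.
elim: l best => [|[a b] l IH] best; first by [].
rewrite search_cons (mulSn (size l)); case: ifP => _.
  by rewrite /= -addnA -add1n leq_add ?addn_gt0 ?orbT.
have := best_exchange_time a b.
case: (best_exchange par dep s a b) => [[gain del] t] /= tt.
rewrite -addSn -addnA; apply: leq_add; last exact: IH.
by apply: leq_ltn_trans tt _; rewrite ltn_add2l.
Qed.

Lemma tree_cost_val l : (tree_cost r l s).1 = \sum_(v <- l | v != r) `|s v|.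
Proof.
elim: l => [|v l IH]; first by rewrite big_nil.
by rewrite big_cons /= IH; case: eqVneq.
Qed.

Lemma tree_cost_time l : (tree_cost r l s).2 = (size l).+1.
Proof. by elim: l => //= v l ->; rewrite addn0. Qed.

End TreePath.

(** * The rounds of the descent *)

Section Rounds.
Variables (R : realType) (V : finType) (e : rel V) (es : seq (V * V)).
Hypotheses (e_sym : symmetric e) (e_irr : irreflexive e) (es_e : edge_list e es).

Lemma edgesE x v : ([set x; v] \in edges e) = e x v.
Proof.
apply/edgesP/idP => [[a [b [E ab]]]|xv]; last by exists x, v.
by case: (set2_inj E) => -[-> ->]; rewrite // e_sym.
Qed.

(** Each edge of the list is incident to x through exactly one other end. *)
Lemma count_incident x (l : seq (V * V)) : {in l, forall p, p.1 != p.2} ->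
  (count_degree x l).1 =
  (\sum_v count (fun p => [set p.1; p.2] == [set x; v]) l)%N.
Proof.
elim: l => [|[u w] l IH] neq; first by rewrite big1.
rewrite /= big_split /= -IH => [|p p_l]; last by apply: neq; rewrite inE p_l orbT.
have /= uw := neq (u, w) (mem_head _ _).
have [<-|ux] := eqVneq u x.
  rewrite (bigD1 w) //= eqxx big1 // => v vw.
  by apply/eqP; rewrite eqb0; apply: contra vw => /eqP/set2_inj[[E1 E2]|[E1 E2]]; apply/eqP; congruence.
have [<-|wx] := eqVneq w x.
  rewrite (bigD1 u) //= setUC eqxx big1 // => v vu.
  by apply/eqP; rewrite eqb0; apply: contra vu => /eqP/set2_inj[[E1 E2]|[E1 E2]]; apply/eqP; congruence.
rewrite big1 // => v _; apply/eqP; rewrite eqb0.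
by apply/eqP => /set2_inj[[E _]|[_ E]]; [rewrite E eqxx in ux | rewrite E eqxx in wx].
Qed.

Lemma count_degree_val x : (count_degree x es).1 = deg e x.
Proof.
rewrite count_incident; last exact: edge_list_neq es_e.
rewrite /deg /nbhd -sum1dep_card [RHS]big_mkcond /=; apply: eq_bigr => v _.
by rewrite (edge_list_count es_e) edgesE; case: (e x v).
Qed.

Lemma count_degree_time x (l : seq (V * V)) : (count_degree x l).2 = (size l).+1.
Proof. by elim: l => [|[u v] l IH] //=; rewrite IH addn0. Qed.

Lemma spread_val x (w : R) (l : seq (V * V)) a v : {in l, forall p, p.1 != p.2} ->
  (spread x w l a).1 v =
  a v + w * (count (fun p => [set p.1; p.2] == [set x; v]) l)%:R.
Proof.
elim: l a => [|[u u'] l IH] a neq; first by rewrite /= mulr0 addr0.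
rewrite /= IH => [|p p_l]; last by apply: neq; rewrite inE p_l orbT.
have /= uu' := neq (u, u') (mem_head _ _).
rewrite natrD mulrDr addrA; congr (_ + _).
have [<-|ux] := eqVneq u x.
  rewrite /upd eq_sym; have [<-|vu] := eqVneq u' v; first by rewrite eqxx mulr1.
  suff /negbTE -> : [set u; u'] != [set u; v] by rewrite mulr0 addr0.
  by apply: contra vu => /eqP/set2_inj[[E1 E2]|[E1 E2]]; apply/eqP; congruence.
have [<-|u'x] := eqVneq u' x.
  rewrite /upd eq_sym; have [<-|vu] := eqVneq u v; first by rewrite setUC eqxx mulr1.
  suff /negbTE -> : [set u; u'] != [set u'; v] by rewrite mulr0 addr0.
  by apply: contra vu => /eqP/set2_inj[[E1 E2]|[E1 E2]]; apply/eqP; congruence.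
suff /negbTE -> : [set u; u'] != [set x; v] by rewrite mulr0 addr0.
by apply/eqP => /set2_inj[[E _]|[_ E]]; [rewrite E eqxx in ux | rewrite E eqxx in u'x].
Qed.

Lemma spread_time x (w : R) (l : seq (V * V)) a : (spread x w l a).2 = (size l).+1.
Proof. by elim: l a => [|[u v] l IH] a //=; rewrite IH. Qed.

Lemma masses_val x y :
  (masses R es x y).1 = fun v => rwalk R e x v - rwalk R e y v.
Proof.
apply: boolp.funext => v; rewrite /masses /= !count_degree_val.
rewrite !spread_val; try exact: edge_list_neq es_e.
rewrite !(edge_list_count es_e) !edgesE add0r /rwalk mulNr.
by case: (e x v); case: (e y v); rewrite ?mulr1 ?mulr0.
Qed.

Lemma masses_time x y : (masses R es x y).2 = (4 * (size es).+1 + #|V|)%N.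
Proof. by rewrite /masses /= !count_degree_time !spread_time; lia. Qed.

Lemma size_edge_list : size es = #|edges e|.
Proof.
have [E_uniq E_e] := es_e; rewrite -(size_map (fun p => [set p.1; p.2])).
by rewrite -(card_uniqP E_uniq); apply: eq_card.
Qed.

Section OneEdge.
Variables x y : V.
Hypothesis xy : e x y.

Lemma rwalk_ge0 z v : 0 <= rwalk R e z v.
Proof. by rewrite /rwalk; case: ifP => // _; rewrite invr_ge0 ler0n. Qed.

Lemma deg_gt0 z v : e z v -> (0 < deg e z)%N.
Proof. by move=> zv; apply/card_gt0P; exists v; rewrite inE. Qed.

Lemma rwalk_sum z v : e z v -> \sum_u rwalk R e z u = 1.
Proof.
move=> zv; rewrite /rwalk -big_mkcond /= sumr_const.
rewrite (_ : #|_| = deg e z); last by apply: eq_card => u; rewrite !inE.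
by rewrite -[_ *+ _]mulr_natr mulVf // pnatr_eq0 -lt0n (deg_gt0 zv).
Qed.

Let sum_x := rwalk_sum xy.
Let sum_y : \sum_u rwalk R e y u = 1.
Proof. by apply: (@rwalk_sum y x); rewrite e_sym. Qed.
Let same_sum : \sum_u rwalk R e x u = \sum_u rwalk R e y u.
Proof. by rewrite sum_x sum_y. Qed.

Lemma spanning_tree_adj T g : spanning_tree e T -> g \in T ->
  exists a b, g = [set a; b] /\ adj_of T a b.
Proof.
move=> /spanning_treeP[sub _ _] gT.
have [a [b [E ab]]] := edgesP _ _ (subsetP sub _ gT).
exists a, b; split=> //; rewrite /adj_of -E gT andbT.
by apply: contraTneq ab => ->; rewrite e_irr.
Qed.

Lemma exchange_gainE T par dep ord a b v : spanning_tree e T ->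
  rooted T x par dep ord ->
  e a b -> [set a; b] \notin T -> separates par a b v ->
  let s := (subtree_sums par x ord (fun u => rwalk R e x u - rwalk R e y u)).1 in
  let T' := ([set a; b] |: T) :\ [set v; par v] in
  tree_adjacent e T T' /\
  WT R e x y T' = WT R e x y T - exchange_gain par s a b v.
Proof.
move=> sT rT ab abT sep_v s T'.
have vr : v != x by apply: contraTneq sep_v => ->; apply: (separates_root rT).
have nab : a != b by apply: contraTneq ab => ->; rewrite e_irr.
have adj : tree_adjacent e T T'.
  apply: exchange_tree => //.
  - by rewrite inE abT edgesE.
  - by case/andP: (par_edge rT vr).
  by rewrite (anc_connect rT).
split=> //; case: adj => _ sT' _.
have [par' [dep' [ord' [_ rT']]]] := root_tree_spec e_irr es_e x sT'.
rewrite /WT (exchange_cost rT (rwalk_ge0 x) (rwalk_ge0 y) same_sum nab abT sep_v rT').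
by rewrite /exchange_gain -/s; lra.
Qed.

Lemma tree_adjacent_separates T T' par dep ord : spanning_tree e T ->
  rooted T x par dep ord -> tree_adjacent e T T' ->
  exists p v, [/\ p \in es, [set p.1; p.2] \notin T, separates par p.1 p.2 v &
                  T' = ([set p.1; p.2] |: T) :\ [set v; par v]].
Proof.
move=> sT rT /(tree_adjacentP e_irr)[a [b [g [ab abT gT nab ET']]]].
have [c [d [Eg cd]]] := spanning_tree_adj sT gT.
have [v [vr Ev]] : exists v, v != x /\ g = [set v; par v].
  by case: (par_adj rT cd) => [[cx Ed]|[dx Ec]]; [exists c | exists d];
     rewrite Eg ?Ed // Ec setUC.
have : [set a; b] \in [seq [set p.1; p.2] | p <- es] by rewrite es_e.2 edgesE.
case/mapP => p p_es Ep; exists p, v; rewrite -Ep -Ev; split=> //.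
move: nab; rewrite Ev (anc_connect rT) // /separates.
by case: (set2_inj Ep) => -[-> ->] //; rewrite eq_sym.
Qed.

(** By [tree_adjacent_separates] and [exchange_gainE] the adjacent trees are
    the exchanges that the search examines, so the largest recorded decrease
    leads to a cheapest adjacent tree. *)
Lemma descent_round_spec T : spanning_tree e T ->
  let round := descent_round es x (masses R es x y).1 T in
  [/\ round.1.1 = WT R e x y T,
      (round.2 <= 245 * (#|edges e| * #|V|))%N &
      if round.1.2 is Some T1 then
        [/\ tree_adjacent e T T1, WT R e x y T1 < WT R e x y T &
            forall T', tree_adjacent e T T' -> WT R e x y T1 <= WT R e x y T']
      else forall T', tree_adjacent e T T' -> WT R e x y T <= WT R e x y T'].
Proof.
move=> sT; rewrite /descent_round masses_val.
have [par [dep [ord [+ rT]]]] := root_tree_spec e_irr es_e x sT.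
have := root_tree_time es T x.
case: (root_tree es T x) => [[[par' dep'] ord'] t] /= time_root [-> -> ->].
have := subtree_sums_time par x ord (fun u => rwalk R e x u - rwalk R e y u).
have := @exchange_gainE T par dep ord _ _ _ sT rT.
have := tree_wasserstein rT (rwalk_ge0 x) (rwalk_ge0 y) same_sum.
case: (subtree_sums par x ord _) => [s t_s] /= costE gainE ->.
have size_ord : size ord = #|V|.
  rewrite -(card_uniqP (leaves_first_uniq (ord_leaves_first rT))).
  by apply: eq_card => v; rewrite !inE (ord_all rT).
have := search_time rT s es (0, None).
have [] := search_spec rT (s := s) (l := es) (best := (0, None)) (fun p h => h) (erefl 0).
case: (search T par dep s es (0, None)) => [[gain del] t_b] /= rec gain0 gain_max time_search.
split.
- by rewrite tree_cost_val (big_ord_list rT) /WT costE.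
- rewrite tree_cost_time size_ord -size_edge_list.
  have V0 : (0 < #|V|)%N by apply/card_gt0P; exists x.
  have E0 : (0 < size es)%N.
    by rewrite size_edge_list; apply/card_gt0P; exists [set x; y]; rewrite edgesE.
  have arith N M a b : (0 < N)%N -> (0 < M)%N ->
    (a <= 3 * N + M + 2 + N * (2 * M + 2))%N -> (b <= M * (204 * N + 25) + 1)%N ->
    (a + (N + (N.+1 + (N.+1 + (b + 0)))) <= 245 * (M * N))%N by nia.
  exact: arith V0 E0 time_root time_search.
have adj_gain T' : tree_adjacent e T T' -> WT R e x y T - gain <= WT R e x y T'.
  case/(tree_adjacent_separates sT rT) => p [v [p_es pT sep_v ->]].
  have ep : e p.1 p.2 by rewrite -edgesE -es_e.2; apply: map_f.
  have [_ ->] := gainE _ _ _ ep pT sep_v.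
  by rewrite lerD2l lerN2; apply: gain_max.
case: del rec => [[f g]|] /=; rewrite /recorded /=; last first.
  by move=> gain_0 T' /adj_gain; rewrite gain_0 subr0.
case=> gain_gt0 [p [v [p_es pT sep_v [-> ->] gain_v]]].
have ep : e p.1 p.2 by rewrite -edgesE -es_e.2; apply: map_f.
have [adj1 W1] := gainE _ _ _ ep pT sep_v; rewrite -gain_v in W1.
by split=> //; rewrite W1 // gtrBl.
Qed.

(** All masses are multiples of 1 / (deg x * deg y), hence so are the costs. *)
Let D : R := (deg e x * deg e y)%:R.

Let D_gt0 : 0 < D.
Proof. by rewrite ltr0n muln_gt0 (deg_gt0 xy) (@deg_gt0 y x) // e_sym. Qed.

Lemma rwalk_int_x v : rwalk R e x v * D \is a Num.int.
Proof.
rewrite /rwalk; case: ifP => _; last by rewrite mul0r.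
by rewrite /D natrM mulKf ?natr_int // pnatr_eq0 -lt0n (deg_gt0 xy).
Qed.

Lemma rwalk_int_y v : rwalk R e y v * D \is a Num.int.
Proof.
rewrite /rwalk; case: ifP => _; last by rewrite mul0r.
rewrite /D mulnC natrM mulKf ?natr_int // pnatr_eq0 -lt0n (@deg_gt0 y x) //.
by rewrite e_sym.
Qed.

Lemma subtree_sums_int par r ord (s : V -> R) :
  (forall v, s v * D \is a Num.int) ->
  forall v, (subtree_sums par r ord s).1 v * D \is a Num.int.
Proof.
elim: ord s => //= v ord IH s s_int; apply: IH => u.
case: ifP => // _; rewrite /upd; case: eqP => // _.
by rewrite mulrDl rpredD.
Qed.

Lemma tree_cost_nat T : spanning_tree e T -> exists n : nat, WT R e x y T * D = n%:R.
Proof.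
move=> sT; have [par [dep [ord [_ rT]]]] := root_tree_spec e_irr es_e x sT.
apply/natrP; rewrite /WT (tree_wasserstein rT (rwalk_ge0 x) (rwalk_ge0 y) same_sum).
rewrite mulr_suml rpred_sum // => v _.
rewrite -[D]gtr0_norm // -normrM natr_norm_int //.
apply: subtree_sums_int => u; rewrite mulrBl rpredB //.
  exact: rwalk_int_x.
exact: rwalk_int_y.
Qed.

Lemma wasserstein_le (h : rel V) mu nu pi : coupling mu nu pi ->
  wasserstein h mu nu <= transport_cost (fun u v => (gdist h u v)%:R) pi :> R.
Proof.
move=> cpl; apply: ge_inf; last by exists pi.
exists 0 => _ [pi' [pi0 _ _] ->].
by apply: sumr_ge0 => u _; apply: sumr_ge0 => v _; rewrite mulr_ge0.
Qed.

(** In the initial tree, each neighbour of x is at distance at most 3 from each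
    neighbour of y, along x and y. *)
Lemma initial_tree_cost T : initial_tree e x y T -> WT R e x y T <= 3.
Proof.
case=> /spanning_treeP[_ con _] sub.
have xu u : e x u -> adj_of T x u.
  move=> xu; rewrite /adj_of; apply/andP; split.
    by apply: contraTneq xu => ->; rewrite e_irr.
  by apply: (subsetP sub); apply/setUP; left; apply/imsetP; exists u; rewrite ?inE.
have yv v : e y v -> v != x -> ~~ e x v -> adj_of T y v.
  move=> yv vx nxv; rewrite /adj_of; apply/andP; split.
    by apply: contraTneq yv => ->; rewrite e_irr.
  apply: (subsetP sub); apply/setUP; right; apply/imsetP; exists v => //.
  by rewrite !inE negb_or vx nxv.
have dist u v : e x u -> e y v -> (gdist (adj_of T) u v <= 3)%N.
  move=> /xu eu ev; rewrite adj_sym in eu.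
  have [->|vx] := eqVneq v x; first by rewrite (leq_trans (gdist_adj eu)).
  have [xv|nxv] := boolP (e x v).
    have := @gdist_le _ (adj_of T) u [:: x; v]; rewrite /= eu (xu _ xv).
    by move=> /(_ isT) le2; apply: leq_trans le2 _.
  have := @gdist_le _ (adj_of T) u [:: x; y; v].
  by rewrite /= eu (xu _ xy) (yv _ ev vx nxv); apply.
pose pi u v := rwalk R e x u * rwalk R e y v.
have cpl : coupling (rwalk R e x) (rwalk R e y) pi.
  split=> [u v|u|v]; first by rewrite mulr_ge0 ?rwalk_ge0.
    by rewrite -mulr_sumr sum_y mulr1.
  by rewrite -mulr_suml sum_x mul1r.
apply: le_trans (wasserstein_le _ cpl) _.
have -> : 3 = \sum_u \sum_v pi u v * 3 :> R.
  under eq_bigr do rewrite -mulr_suml -mulr_sumr sum_y mulr1.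
  by rewrite -mulr_suml sum_x mul1r.
apply: ler_sum => u _; apply: ler_sum => v _; rewrite /pi /rwalk.
case: (boolP (e x u)) => xu'; last by rewrite !mul0r.
case: (boolP (e y v)) => yv'; last by rewrite mulr0 !mul0r.
by rewrite ler_wpM2l ?mulr_ge0 ?invr_ge0 ?ler0n // ler_nat dist.
Qed.

Notation round := (descent_round es x (masses R es x y).1).

(** Each move lowers the natural number W_T * deg x * deg y, which therefore
    bounds the number of moves. *)
Lemma descent_loop_total N T : spanning_tree e T -> WT R e x y T * D <= N%:R ->
  exists T' n,
    [/\ descent_loop round T T' (WT R e x y T') n,
        steepest_descent R e x y T T' &
        (n <= N.+1 * (245 * (#|edges e| * #|V|)))%N].
Proof.
elim: N T => [|N IH] T sT WN; have [cost time next] := descent_round_spec sT;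
  case E: (round T) cost time next => [[w [T1|]] t] /= Ew time next;
  rewrite Ew in E.
- case: next => -[_ sT1 _] lt1 _.
  have [m1 Em1] := tree_cost_nat sT1.
  have : WT R e x y T1 * D < WT R e x y T * D by rewrite ltr_pM2r.
  by rewrite Em1 => /lt_le_trans /(_ WN); rewrite ltr_nat.
- exists T, t; split; [exact: loop_stop E | exact: descent_stop | by rewrite mul1n].
- case: next => adj1 lt1 min1; have [_ sT1 _] := adj1.
  have [m1 Em1] := tree_cost_nat sT1.
  have : WT R e x y T1 * D < WT R e x y T * D by rewrite ltr_pM2r.
  rewrite Em1 => /lt_le_trans /(_ WN); rewrite ltr_nat ltnS => m1N.
  have [|T' [n [loop desc n_le]]] := IH T1 sT1; first by rewrite Em1 ler_nat.
  exists T', (t + n)%N; split.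
  + exact: loop_move E loop.
  + exact: descent_move adj1 lt1 min1 desc.
  by rewrite mulSn leq_add.
exists T, t; split; [exact: loop_stop E | exact: descent_stop |].
by apply: leq_trans time _; rewrite leq_pmull.
Qed.

Lemma curvature_edge : curvature R e x y = 1 - WG R e x y.
Proof.
rewrite /curvature; have -> : gdist e x y = 1%N; last by rewrite divr1.
apply/eqP; rewrite eqn_leq gdist_adj // lt0n; apply/eqP => d0.
have [p []] := gdist_path (connect1 xy); rewrite d0 => _ + /size0nil Ep.
by rewrite Ep /= => Exy; move: xy; rewrite Exy e_irr.
Qed.

(** There are at most 3 deg x deg y + 1 <= 4 Delta^2 rounds of cost 245 |E| |V|,
    and setting up the masses costs at most 9 |E| |V|: 989 = 4 * 245 + 9. *)
Lemma edge_run_total T : initial_tree e x y T ->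
  exists T' n,
    [/\ edge_run es (x, y) T T' (1 - WT R e x y T') n,
        steepest_descent R e x y T T' &
        (n <= 989 * (#|edges e| * #|V| * maxdeg e ^ 2))%N].
Proof.
move=> iT; have sT := iT.1.
have [|T' [n [loop desc n_le]]] := @descent_loop_total (3 * (deg e x * deg e y)) T sT.
  by rewrite natrM ler_pM2r // initial_tree_cost.
exists T', ((masses R es x y).2 + n)%N; split=> //.
  by exists (WT R e x y T'), n.
have V0 : (0 < #|V|)%N by apply/card_gt0P; exists x.
have E0 : (0 < #|edges e|)%N by apply/card_gt0P; exists [set x; y]; rewrite edgesE.
have dx : (0 < deg e x <= maxdeg e)%N.
  by rewrite (deg_gt0 xy) leq_bigmax.
have dy : (0 < deg e y <= maxdeg e)%N.
  by rewrite (@deg_gt0 y x) ?leq_bigmax // e_sym.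
rewrite masses_time size_edge_list.
set M := #|edges e| in n_le E0 *; set N := #|V| in n_le V0 *.
set k := (maxdeg e ^ 2)%N.
have dd : (deg e x * deg e y <= k)%N.
  by rewrite /k -mulnn; case/andP: dx => _ ?; case/andP: dy => _ ?; apply: leq_mul.
have k0 : (0 < k)%N.
  by apply: leq_trans dd; rewrite muln_gt0; case/andP: dx => -> _; case/andP: dy.
have le1 : (n <= 4 * k * (245 * (M * N)))%N.
  by apply: leq_trans n_le _; rewrite leq_mul2r; apply/orP; right; lia.
have MN : (M <= M * N)%N by rewrite leq_pmulr.
have NM : (N <= M * N)%N by rewrite leq_pmull.
have MNk : (M * N <= M * N * k)%N by rewrite leq_pmulr.
rewrite mulnC !mulnA in le1 *; lia.
Qed.

End OneEdge.
End Rounds.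

Theorem mainTheorem6 :
  exists C : nat,
  forall (R : realType) (V : finType) (e : rel V) (es : seq (V * V))
         (Tinit : V * V -> {set {set V}}),
    symmetric e -> irreflexive e -> connected e ->
    edge_list e es ->
    (forall p, p \in es -> initial_tree e p.1 p.2 (Tinit p)) ->
    exists (Tfinal : V * V -> {set {set V}}) (output : V * V -> R)
           (time : V * V -> nat),
      [/\ forall p, p \in es ->
            edge_run es p (Tinit p) (Tfinal p) (output p) (time p),
          forall p, p \in es ->
            [/\ steepest_descent R e p.1 p.2 (Tinit p) (Tfinal p),
                output p = 1 - WT R e p.1 p.2 (Tfinal p) &
                WT R e p.1 p.2 (Tfinal p) = WG R e p.1 p.2 ->
                output p = curvature R e p.1 p.2] &
          (\sum_(p <- es) time p
             <= C * (#|edges e| ^ 2 * #|V| * maxdeg e ^ 2))%N].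
Proof.
exists 989%N => R V e es Tinit e_sym e_irr _ es_e initT.
have total p : exists T'n : {set {set V}} * nat, p \in es ->
    [/\ edge_run es p (Tinit p) T'n.1 (1 - WT R e p.1 p.2 T'n.1) T'n.2,
        steepest_descent R e p.1 p.2 (Tinit p) T'n.1 &
        (T'n.2 <= 989 * (#|edges e| * #|V| * maxdeg e ^ 2))%N].
  have [p_es|] := boolP (p \in es); last by exists (finset.set0, 0%N).
  have ep : e p.1 p.2 by rewrite -(edgesE e_sym); apply: edge_list_adj es_e _ p_es.
  have [T' [n [run desc time]]] := edge_run_total R e_sym e_irr es_e ep (initT _ p_es).
  by exists (T', n); case: p run desc time {p_es ep} => x y.
have [run runP] := boolp.choice total.
exists (fun p => (run p).1), (fun p => 1 - WT R e p.1 p.2 (run p).1), (fun p => (run p).2).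
split=> [p /runP[]//|p p_es|].
  have [_ desc _] := runP p p_es.
  have ep : e p.1 p.2 by rewrite -(edgesE e_sym); apply: edge_list_adj es_e _ p_es.
  by split=> // ->; rewrite (curvature_edge R e_irr ep).
apply: (@leq_trans (\sum_(p <- es) 989 * (#|edges e| * #|V| * maxdeg e ^ 2))%N).
  rewrite big_seq [X in (_ <= X)%N]big_seq; apply: leq_sum => p /runP[].
  by [].
rewrite big_const_seq count_predT iter_addn_0 (size_edge_list es_e).
by rewrite -mulnn; lia.
Qed.
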